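(* Let $(\mathcal F,S(T\mathcal F),S(T\mathcal F^\perp))$ be an $r$-lightlike foliation (with a choice of screen distributions) of codimension $q$ of an $n$-dimensional semi-Riemannian manifold $(M,g)$ such that $1\le r\le m-1$ and $1\le r\le q-1$, where $m=n-q$. Assume that $\mathrm{Rad}\,T\mathcal F$ is trivial, let $\xi=(\xi_1,\dots,\xi_r)$ be a global frame of $\mathrm{Rad}\,T\mathcal F$, and let $E$ be a complement to $\mathrm{Rad}\,T\mathcal F$ in $S(T\mathcal F^\perp)^\perp$. Define $\kappa=\kappa(\xi,E)$ by setting $$\kappa(X)=0,\quad X\in T(\mathcal F),\qquad \kappa(Z)=\sum_{i=1}^r\lambda^i([Z,\xi_i])+\sum_{a=1}^{m-r}\epsilon_a\,\omega^a([Z,X_a]),\quad Z\in tr(T\mathcal F).$$ Then $\kappa\in\Omega^1(M)$, i.e. $\kappa$ is globally defined and its definition does not depend upon the choice of local orthonormal frames $\{X_a\}\subset S(T\mathcal F)$ and $\{W_\alpha\}\subset S(T\mathcal F^\perp)$. If $\mathcal F$ is tangentially screen oriented then $$\mathcal L_Z\chi_{\mathcal F}+\kappa(Z)\chi_{\mathcal F}=0$$ on $T(\mathcal F)\otimes\cdots\otimes T(\mathcal F)$ for any $Z\in tr(T\mathcal F)$.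
   Context: Let $(M,g)$ be a semi-Riemannian manifold and $\mathcal F$ a foliation with tangent bundle $T(\mathcal F)$ of rank $m=n-q$; $T(\mathcal F)^\perp$ is the $g$-orthogonal complement and $\mathrm{Rad}\,T\mathcal F=T(\mathcal F)\cap T(\mathcal F)^\perp$. $\mathcal F$ is $r$-lightlike if $\mathrm{Rad}\,T\mathcal F$ is a subbundle of rank $r\geq 1$. Screen distributions are complements $T(\mathcal F)=S(T\mathcal F)\oplus\mathrm{Rad}\,T\mathcal F$, $T(\mathcal F)^\perp=S(T\mathcal F^\perp)\oplus\mathrm{Rad}\,T\mathcal F$; both are nondegenerate. One has $S(T\mathcal F^\perp)\subseteq S(T\mathcal F)^\perp$, and $S(T\mathcal F^\perp)^\perp$ denotes the orthogonal complement of $S(T\mathcal F^\perp)$ inside $S(T\mathcal F)^\perp$ (a bundle of rank $2r$ containing $\mathrm{Rad}\,T\mathcal F$). $E$ is a fixed subbundle with $S(T\mathcal F^\perp)^\perp=(\mathrm{Rad}\,T\mathcal F)\oplus E$. For a local frame $\{V_i\}$ of $E$ put $g_{jk}=g(\xi_j,V_k)$ (an invertible matrix), $[g^{jk}]=[g_{jk}]^{-1}$ and $$N_i=\sum_k g^{ki}V_k-\frac12\sum_{j,k,\ell}g^{ki}g^{\ell j}g(V_k,V_\ell)\,\xi_j .$$ The $N_i$ do not depend on the choice of $\{V_i\}$, hence are globally defined, and satisfy $g(\xi_i,N_j)=\delta_{ij}$, $g(N_i,N_j)=0$. $ltr(T\mathcal F)$ is the span of $N_1,\dots,N_r$, and $tr(T\mathcal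 F)=ltr(T\mathcal F)\oplus S(T\mathcal F^\perp)$, so $T(M)=T(\mathcal F)\oplus tr(T\mathcal F)$. In ''$Z\in tr(T\mathcal F)$'', $Z$ is a (local) section. $\{X_a:1\le a\le m-r\}$ and $\{W_\alpha:1\le\alpha\le q-r\}$ are local orthonormal frames of $S(T\mathcal F)$ and $S(T\mathcal F^\perp)$: $g(X_a,X_b)=\epsilon_a\delta_{ab}$, $g(W_\alpha,W_\beta)=\epsilon_\alpha\delta_{\alpha\beta}$, with $\epsilon_a,\epsilon_\alpha\in\{\pm1\}$. $\lambda^i(X)=g(X,N_i)$ and $\omega^a(X)=g(X,X_a)$ for $X\in T(M)$. $\mathcal F$ is tangentially screen oriented if $S(T\mathcal F)$ is oriented; then the local forms $\omega^1\wedge\cdots\wedge\omega^{m-r}$ (from positively oriented frames) glue to a global $(m-r)$-form $\chi_{S(T\mathcal F)}$, and $\chi_{\mathcal F}=\lambda^1\wedge\cdots\wedge\lambda^r\wedge\chi_{S(T\mathcal F)}$, a global $m$-form on $M$. $\mathcal L_Z$ is the Lie derivative. *)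

(* Defs.v *)
From mathcomp Require Import all_boot all_order all_algebra.
From mathcomp Require Import all_classical all_reals all_analysis.

Set Implicit Arguments.
Unset Strict Implicit.
Unset Printing Implicit Defensive.

Import Order.TTheory GRing.Theory Num.Theory.
Import numFieldNormedType.Exports.

Local Open Scope classical_set_scope.
Local Open Scope ring_scope.

(* f is C^(k+1) on the open set A iff it is differentiable on A and x |-> df_x(v) is C^k on A
   for every v.  In finite dimension this is the usual definition. *)
Fixpoint Ck (R : realType) (V W : normedModType R) (k : nat) (A : set V) (f : V -> W)
    : Prop :=
  (forall x, A x -> {for x, continuous f}) /\
  if k is k'.+1 then
    (forall x, A x -> differentiable f x) /\
    (forall v : V, Ck k' A (fun x => 'd f x v))
  else True.

Definition smooth (R : realType) (V W : normedModType R) (A : set V) (f : V -> W) : Prop :=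
  forall k, Ck k A f.

(* cmap is a homeomorphism from the open set cdom onto an open subset of R^n, with inverse
   cinv.  Outside cdom (resp. its image), cmap (resp. cinv) takes irrelevant values. *)
Record chart (R : realType) (M : topologicalType) (n : nat) := Chart {
  cdom : set M;
  cmap : M -> 'rV[R]_n;
  cinv : 'rV[R]_n -> M;
  cdom_open : open cdom;
  cimg_open : open (cmap @` cdom);
  cmapK : {in cdom, cancel cmap cinv};
  cmap_continuous : forall p, cdom p -> {for p, continuous cmap};
  cinv_continuous : forall x, (cmap @` cdom) x -> {for x, continuous cinv}
}.

Definition smooth_transition (R : realType) (M : topologicalType) (n : nat)
    (c d : chart R M n) : Prop :=
  smooth (cmap c @` (cdom c `&` cdom d)) (cmap d \o cinv c).

(* A smooth n-manifold.  The atlas need not be maximal; chart_at selects, for each point, a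
   chart of the atlas around it. *)
Record manifold (R : realType) (n : nat) := Manifold {
  carrier :> topologicalType;
  carrier_hausdorff : hausdorff_space carrier;
  carrier_second_countable : @second_countable carrier;
  atlas : set (chart R carrier n);
  atlas_smooth : forall c d, atlas c -> atlas d -> smooth_transition c d;
  chart_at : carrier -> chart R carrier n;
  chart_at_atlas : forall p, atlas (chart_at p);
  chart_at_dom : forall p, cdom (chart_at p) p
}.

(* The tangent space T_pM is represented by 'rV_n: a tangent vector at p is its row of
   components in the chart (chart_at p).  Since chart_at p varies with p, these components
   are never to be compared at different points; [tcomp c p v] is the row of components of
   v in an arbitrary chart c around p, and [tvec c p] is the inverse map, sending a to
   \sum_i a_i d/dx^i at p. *)
Definition tcomp (R : realType) (n : nat) (M : manifold R n) (c : chart R M n) (p : M)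
    (v : 'rV[R]_n) : 'rV[R]_n :=
  'd (cmap c \o cinv (chart_at p)) (cmap (chart_at p) p) v.

Definition tvec (R : realType) (n : nat) (M : manifold R n) (c : chart R M n) (p : M)
    (a : 'rV[R]_n) : 'rV[R]_n :=
  'd (cmap (chart_at p) \o cinv c) (cmap c p) a.

(* Vector fields, distributions, covector fields, ... on an open set U are given by total
   functions on M; only their values on U matter. *)
Definition vfield (R : realType) (n : nat) (M : manifold R n) := M -> 'rV[R]_n.

Definition smooth_vfield (R : realType) (n : nat) (M : manifold R n) (U : set M)
    (X : vfield M) : Prop :=
  forall c, atlas c ->
    smooth (cmap c @` (U `&` cdom c))
           (fun x => tcomp c (cinv c x) (X (cinv c x))).

(* The function X f. *)
Definition vderiv (R : realType) (n : nat) (M : manifold R n) (X : vfield M) (f : M -> R)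
    (p : M) : R :=
  'd (f \o cinv (chart_at p) : 'rV[R]_n -> R) (cmap (chart_at p) p) (X p).

(* The i-th component of [X, Y] at p is [X, Y] x^i = X (Y x^i) - Y (X x^i), where the x^i
   are the coordinate functions of the chart (chart_at p). *)
Definition lie_bracket (R : realType) (n : nat) (M : manifold R n) (X Y : vfield M)
    : vfield M :=
  fun p =>
    \row_i (let xi := fun z : M => cmap (chart_at p) z 0 i in
            vderiv X (vderiv Y xi) p - vderiv Y (vderiv X xi) p).

(* The subspace of T_pM attached to p is the row space of the matrix D p. *)
Definition tdistribution (R : realType) (n : nat) (M : manifold R n) := M -> 'M[R]_n.

Definition vsection (R : realType) (n : nat) (M : manifold R n) (U : set M)
    (D : tdistribution M) (X : vfield M) : Prop :=
  smooth_vfield U X /\ forall p, U p -> (X p <= D p)%MS.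

(* The matrix whose rows are X_0(p), ..., X_(k-1)(p). *)
Definition frame_mx (R : realType) (n : nat) (M : manifold R n) (k : nat)
    (X : 'I_k -> vfield M) (p : M) : 'M[R]_(k, n) :=
  \matrix_a X a p.

Definition is_basis (R : realType) (k n : nat) (D : 'M[R]_n) (B : 'M[R]_(k, n)) : Prop :=
  row_free B /\ (B :=: D)%MS.

Definition is_frame (R : realType) (n : nat) (M : manifold R n) (k : nat) (U : set M)
    (D : tdistribution M) (X : 'I_k -> vfield M) : Prop :=
  (forall a, smooth_vfield U (X a)) /\
  (forall p, U p -> is_basis (D p) (frame_mx X p)).

Definition subbundle (R : realType) (n : nat) (M : manifold R n) (k : nat)
    (D : tdistribution M) : Prop :=
  forall p, exists (U : set M) (X : 'I_k -> vfield M),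
    [/\ open U, U p & is_frame U D X].

(* D = A (+) B *)
Definition is_direct_sum (R : realType) (n : nat) (M : manifold R n)
    (D A B : tdistribution M) : Prop :=
  forall p, (D p :=: A p + B p)%MS /\ (A p :&: B p)%MS = 0.

Definition neg_definite (R : realType) (n : nat) (G W : 'M[R]_n) : Prop :=
  forall v : 'rV[R]_n, (v <= W)%MS -> v != 0 -> (v *m G *m v^T) 0 0 < 0.

Definition has_index (R : realType) (n : nat) (G : 'M[R]_n) (nu : nat) : Prop :=
  (exists2 W : 'M[R]_n, neg_definite G W & \rank W = nu) /\
  (forall W : 'M[R]_n, neg_definite G W -> (\rank W <= nu)%N).

(* A semi-Riemannian metric: a smooth symmetric nondegenerate (0,2)-tensor field of
   constant index.  [gram p] is the Gram matrix of g_p on T_pM = 'rV_n. *)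
Record metric (R : realType) (n : nat) (M : manifold R n) := Metric {
  gram :> M -> 'M[R]_n;
  gram_sym : forall p, (gram p)^T = gram p;
  gram_nondegenerate : forall p, gram p \in unitmx;
  gram_index : exists nu, forall p, has_index (gram p) nu;
  gram_smooth : forall (c : chart R M n) (a b : 'rV[R]_n), atlas c ->
    smooth (cmap c @` cdom c)
      (fun x => let p := cinv c x in
                (tvec c p a *m gram p *m (tvec c p b)^T) 0 0 : R)
}.

Definition ip (R : realType) (n : nat) (M : manifold R n) (g : metric M) (p : M)
    (u v : 'rV[R]_n) : R :=
  (u *m g p *m v^T) 0 0.

(* The g-orthogonal complement. *)
Definition orth (R : realType) (n : nat) (M : manifold R n) (g : metric M)
    (D : tdistribution M) : tdistribution M :=
  fun p => kermx (g p *m (D p)^T).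

(* A covector at p is a column; the covector field v |-> g(v, X). *)
Definition cofield (R : realType) (n : nat) (M : manifold R n) := M -> 'cV[R]_n.

Definition pairing (R : realType) (n : nat) (w : 'cV[R]_n) (v : 'rV[R]_n) : R :=
  (v *m w) 0 0.

Definition flat (R : realType) (n : nat) (M : manifold R n) (g : metric M) (p : M)
    (u : 'rV[R]_n) : 'cV[R]_n :=
  g p *m u^T.

Definition smooth_oneform (R : realType) (n : nat) (M : manifold R n) (w : cofield M)
    : Prop :=
  forall (c : chart R M n) (a : 'rV[R]_n), atlas c ->
    smooth (cmap c @` cdom c)
      (fun x => let p := cinv c x in pairing (w p) (tvec c p a)).

(* A foliation of codimension q with m-dimensional leaves, given by a foliated atlas:
   charts with values in R^m x R^q, compatible with the smooth structure, whose changes of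
   coordinates are locally of the form (x, y) |-> (h1(x, y), h2(y)). *)
Record foliation (R : realType) (m q : nat) (M : manifold R (m + q)) := Foliation {
  fatlas : set (chart R M (m + q));
  fatlas_smooth : forall c d, fatlas c -> atlas d ->
    smooth_transition c d /\ smooth_transition d c;
  fatlas_foliated : forall c d, fatlas c -> fatlas d ->
    forall p, cdom c p -> cdom d p ->
      exists2 A : set 'rV[R]_(m + q), nbhs (cmap c p) A &
        forall x x', A x -> A x' -> rsubmx x = rsubmx x' ->
          rsubmx (cmap d (cinv c x)) = rsubmx (cmap d (cinv c x'));
  fchart_at : M -> chart R M (m + q);
  fchart_at_fatlas : forall p, fatlas (fchart_at p);
  fchart_at_dom : forall p, cdom (fchart_at p) p
}.

(* T(F): the span of d/dx^1, ..., d/dx^m in any foliated chart (x, y). *)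
Definition TF (R : realType) (m q : nat) (M : manifold R (m + q)) (F : foliation M)
    : tdistribution M :=
  fun p => (<<\matrix_(i < m) tvec (fchart_at F p) p (delta_mx 0 (lshift q i))>>)%MS.

Definition RadTF (R : realType) (m q : nat) (M : manifold R (m + q)) (g : metric M)
    (F : foliation M) : tdistribution M :=
  fun p => (TF F p :&: orth g (TF F) p)%MS.

Definition lightlike (R : realType) (m q : nat) (M : manifold R (m + q)) (r : nat)
    (g : metric M) (F : foliation M) : Prop :=
  (1 <= r)%N /\ subbundle r (RadTF g F).

(* S = S(TF) and S' = S(TF^perp) *)
Definition screens (R : realType) (m q : nat) (M : manifold R (m + q)) (r : nat)
    (g : metric M) (F : foliation M) (S S' : tdistribution M) : Prop :=
  [/\ subbundle (m - r) S, subbundle (q - r) S',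
      is_direct_sum (TF F) S (RadTF g F)
    & is_direct_sum (orth g (TF F)) S' (RadTF g F)].

(* The orthogonal complement of S(TF^perp) inside S(TF)^perp. *)
Definition screen_orth (R : realType) (n : nat) (M : manifold R n) (g : metric M)
    (S S' : tdistribution M) : tdistribution M :=
  fun p => (orth g S p :&: orth g S' p)%MS.

(* The formula for N_i at p in terms of the values xi_j(p), V_k(p) of the frames; H is
   [g^(jk)], the inverse of [g(xi_j, V_k)]. *)
Definition null_dual (R : realType) (n : nat) (M : manifold R n) (g : metric M) (r : nat)
    (p : M) (xi V : 'I_r -> 'rV[R]_n) (i : 'I_r) : 'rV[R]_n :=
  let H : 'M[R]_r := invmx (\matrix_(j, k) ip g p (xi j) (V k)) in
  \sum_k H k i *: V k
    - 2^-1 *: \sum_j \sum_k \sum_l (H k i * H l j * ip g p (V k) (V l)) *: xi j.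

(* The global vector field N_i.  Its value at p only involves V_1(p), ..., V_r(p) and is the
   same for all bases of E_p, so it is computed with an arbitrarily selected one. *)
Definition Nfield (R : realType) (n : nat) (M : manifold R n) (g : metric M) (r : nat)
    (E : tdistribution M) (xi : 'I_r -> vfield M) (i : 'I_r) : vfield M :=
  fun p =>
    let V : 'M[R]_(r, n) := xget 0 [set B | is_basis (E p) B] in
    null_dual g p (fun j => xi j p) (fun k => row k V) i.

Definition ltrTF (R : realType) (n : nat) (M : manifold R n) (g : metric M) (r : nat)
    (E : tdistribution M) (xi : 'I_r -> vfield M) : tdistribution M :=
  fun p => (<<frame_mx (Nfield g E xi) p>>)%MS.

Definition trTF (R : realType) (n : nat) (M : manifold R n) (g : metric M) (r : nat)
    (S' E : tdistribution M) (xi : 'I_r -> vfield M) : tdistribution M :=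
  fun p => (ltrTF g E xi p + S' p)%MS.

Definition lambda_form (R : realType) (n : nat) (M : manifold R n) (g : metric M) (r : nat)
    (E : tdistribution M) (xi : 'I_r -> vfield M) (i : 'I_r) : cofield M :=
  fun p => flat g p (Nfield g E xi i p).

Definition orthonormal (R : realType) (n : nat) (M : manifold R n) (g : metric M) (k : nat)
    (p : M) (X : 'I_k -> 'rV[R]_n) (eps : 'I_k -> R) : Prop :=
  (forall a, eps a = 1 \/ eps a = -1) /\
  (forall a b, ip g p (X a) (X b) = if a == b then eps a else 0).

Definition orthonormal_frame (R : realType) (n : nat) (M : manifold R n) (g : metric M)
    (k : nat) (U : set M) (D : tdistribution M) (X : 'I_k -> vfield M) (eps : 'I_k -> R)
    : Prop :=
  is_frame U D X /\ forall p, U p -> orthonormal g p (fun a => X a p) eps.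

(* kappa = kappa(xi, E) as prescribed by its values on T(F) and on local sections of
   tr(TF).  The frame W does not occur in the formula. *)
Definition is_kappa (R : realType) (m q r : nat) (M : manifold R (m + q)) (g : metric M)
    (F : foliation M) (S S' E : tdistribution M) (xi : 'I_r -> vfield M)
    (kappa : cofield M) : Prop :=
  (forall p (v : 'rV[R]_(m + q)), (v <= TF F p)%MS -> pairing (kappa p) v = 0) /\
  (forall (U : set M) (X : 'I_(m - r) -> vfield M) (epsX : 'I_(m - r) -> R)
          (W : 'I_(q - r) -> vfield M) (epsW : 'I_(q - r) -> R) (Z : vfield M),
     open U ->
     orthonormal_frame g U S X epsX -> orthonormal_frame g U S' W epsW ->
     vsection U (trTF g S' E xi) Z ->
     forall p, U p ->
       pairing (kappa p) (Z p) =
         \sum_(i < r) pairing (lambda_form g E xi i p) (lie_bracket Z (xi i) p)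
         + \sum_(a < m - r) epsX a * pairing (flat g p (X a p)) (lie_bracket Z (X a) p)).

(* An orientation of the rank k bundle D: O p selects one of the two classes of bases of
   D_p, and smooth local frames made of selected bases exist around every point. *)
Definition orientation (R : realType) (n : nat) (M : manifold R n) (k : nat)
    (D : tdistribution M) (O : M -> 'M[R]_(k, n) -> bool) : Prop :=
  (forall p (B : 'M[R]_(k, n)) (A : 'M[R]_k), is_basis (D p) B -> A \in unitmx ->
     O p (A *m B) = (O p B == (0 < \det A))) /\
  (forall p, exists (U : set M) (X : 'I_k -> vfield M),
     [/\ open U, U p, is_frame U D X & forall x, U x -> O x (frame_mx X x)]).

(* A field of k-linear forms. *)
Definition kform (R : realType) (n : nat) (M : manifold R n) (k : nat) :=
  M -> ('I_k -> 'rV[R]_n) -> R.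

Definition wedge_covectors (R : realType) (n k : nat) (theta : 'I_k -> 'cV[R]_n)
    (v : 'I_k -> 'rV[R]_n) : R :=
  \det (\matrix_(i, j) pairing (theta i) (v j)).

(* chi_F = lambda^1 /\ ... /\ lambda^r /\ omega^1 /\ ... /\ omega^(m-r), a form of degree
   r + s = m, where s = m - r.  At p, omega^1 /\ ... /\ omega^s is the same for all
   positively oriented orthonormal bases of S(TF)_p (it is chi_S(TF) at p), so it is
   computed with an arbitrarily selected one. *)
Definition chiF (R : realType) (n : nat) (M : manifold R n) (g : metric M) (r s : nat)
    (S E : tdistribution M) (xi : 'I_r -> vfield M) (O : M -> 'M[R]_(s, n) -> bool)
    : kform M (r + s) :=
  fun p =>
    let X : 'M[R]_(s, n) :=
      xget 0 [set B | [/\ is_basis (S p) B, O p B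
                        & exists eps, orthonormal g p (fun a => row a B) eps]] in
    wedge_covectors (fun i => match fintype.split i with
                    | inl j => lambda_form g E xi j p
                    | inr a => flat g p (row a X)
                    end).

(* (L_Z chi)(Y_1, ..., Y_k)
     = Z (chi (Y_1, ..., Y_k)) - \sum_i chi (Y_1, ..., [Z, Y_i], ..., Y_k) *)
Definition lie_deriv (R : realType) (n : nat) (M : manifold R n) (k : nat) (Z : vfield M)
    (chi : kform M k) (Y : 'I_k -> vfield M) (p : M) : R :=
  vderiv Z (fun x => chi x (fun j => Y j x)) p
  - \sum_i chi p (fun j => if j == i then lie_bracket Z (Y i) p else Y j p).

(* Main.v *)
Require Import Defs.
From mathcomp Require Import all_boot all_order all_algebra.
From mathcomp Require Import all_classical all_reals all_analysis.
From HB Require Import structures.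
From mathcomp Require Import perm ring lra.

Set Implicit Arguments.
Unset Strict Implicit.
Unset Printing Implicit Defensive.

Import Order.TTheory GRing.Theory Num.Theory.
Import numFieldNormedType.Exports.

Local Open Scope classical_set_scope.
Local Open Scope ring_scope.

(** Let B = (xi_1, ..., xi_r, X_1, ..., X_(m-r)) be the frame of T(F) built from xi and
    a local orthonormal frame X of S(TF), and let Theta be the matrix of the covectors
    lambda^1, ..., lambda^r, eps_1 omega^1, ..., eps_(m-r) omega^(m-r).  Linear algebra in
    one tangent space (in particular the nondegeneracy of both screens, which makes the
    matrix g(xi_j, V_k) invertible) shows that Theta is the coframe dual to B and that its
    common kernel is tr(TF): see [frame_coframe] and [coframe_kernel].  The expression
    that defines kappa(Z) is therefore the trace of the endomorphism of T(F) that sends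
    B_k to the T(F)-component of [Z, B_k]; in matrix form it is tr(L Theta), where the rows
    of L are the brackets [Z, B_k] ([kappa_trace]).

    Tensoriality.  On tr(TF) one has Z Theta = 0.  Differentiating this identity moves the
    derivative of Z onto Theta, so tr(L Theta) at p depends on Z only through Z(p), by
    an explicit formula ([trace_form_section]) that is linear in Z(p) and smooth in the
    coordinates of any chart.  The formula may be used in every chart because the Lie
    bracket, defined at p in one chosen chart, transforms as a vector
    ([lie_bracket_chart]): the second derivatives of the change of coordinates cancel by
    Schwarz's theorem ([schwarz]).

    Independence of the frame.  If B1 = A B is the frame given by another orthonormal
    frame of S(TF), the trace changes by tr(Z(A) A^-1).  Both frames have constant Gram
    matrices D, D1 for one and the same form on T(F) (the metric, made definite on the
    radical by means of the lambda^i), so A D A^T = D1, and differentiating this gives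
    tr(Z(A) A^-1) = 0 ([trace_frame_indep]).  Existence of kappa follows.
    Uniqueness and smoothness follow from the explicit formula, because smooth
    orthonormal frames of both screens exist near every point ([orthonormalize], a
    Gram-Schmidt process for indefinite forms) and every vector of tr(TF) extends to a
    local section.

    The Lie derivative.  With respect to a positively oriented orthonormal frame, chi_F is
    a constant times the determinant of the components: if Y = A B then
    chi_F(Y) = d det A.  Since [Z, Y] has components Z(A) + A (L Theta), Jacobi's formula
    for the derivative of a determinant turns L_Z chi_F (Y) into
    d (tr(Z(A) adj A) - tr((Z(A) + A L Theta) adj A)) = - d det A tr(L Theta), which is
    - kappa(Z) chi_F(Y) ([lie_deriv_volume]). *)

(** * Functions of class C^k *)
Section Calculus.
Context {R : realType} {V : normedModType R}.
Implicit Types (A : set V) (k : nat).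

(** ['d f x] is selected among the continuous linear maps that approximate f near x; that it
    depends only on the germ of f at x is a consequence of their uniqueness. *)
Lemma near_eq_diff (W : normedModType R) (f g : V -> W) x :
  (\forall y \near x, f y = g y) -> differentiable f x -> is_diff x g ('d f x).
Proof.
move=> fg df; have [cf ef] := (diff_locallyP x f).1 df.
have gE : g \o shift x = cst (g x) + 'd f x +o_ 0 id.
  apply/eqaddoP => e e0; move/eqaddoP: ef => /(_ e e0) ef.
  have sfg : \forall h \near (0 : V), f (h + x) = g (h + x).
    have cv : (h + x) @[h --> (0 : V)] --> x.
      by rewrite -[X in _ --> X](add0r x); apply: cvgD; [exact: cvg_id | exact: cvg_cst].
    exact: (cv _ fg).
  apply: filterS2 sfg ef => h fh.
  by rewrite !fctE /= /shift /= fh (nbhs_singleton fg).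
by apply: DiffDef; [apply/diff_locallyP; rewrite (diff_unique cf gE) | exact: diff_unique].
Qed.

Lemma is_diff_near (W : normedModType R) (f g : V -> W) df x :
  (\forall y \near x, f y = g y) -> is_diff x f df -> is_diff x g df.
Proof. by move=> fg [fd <-]; exact: near_eq_diff. Qed.

Lemma open_near A x (P : V -> Prop) : open A -> A x -> (forall y, A y -> P y) ->
  \forall y \near x, P y.
Proof. by move=> oA Ax AP; apply: filterS AP _; exact: open_nbhs_nbhs. Qed.

Section Ck_basic.
Context {W : normedModType R}.
Implicit Types f g : V -> W.

Lemma Ck_sub k A B f : B `<=` A -> Ck k A f -> Ck k B f.
Proof.
elim: k f => [|k IH] f BA /= [cf H]; split; try by move=> x /BA; apply: cf.
- by [].
- by case: H => df Hd; split=> [x /BA /df//|v]; apply: IH.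
Qed.

Lemma CkS k A f : Ck k.+1 A f -> Ck k A f.
Proof.
elim: k f => [|k IH] f [cf [df Hd]]; first by split.
by split=> //; split=> // v; apply: IH.
Qed.

Lemma Ck_congr k A f g : open A -> (forall x, A x -> f x = g x) -> Ck k A f -> Ck k A g.
Proof.
move=> oA; elim: k f g => [|k IH] f g fg [cf H].
  split=> // x Ax; have c : f @ x --> g x by rewrite -(fg _ Ax); exact: cf.
  apply: cvg_trans c; apply: near_eq_cvg.
  by apply: open_near oA Ax _ => y; apply: fg.
have d x : A x -> is_diff x g ('d f x).
  move=> Ax; apply: near_eq_diff; last by case: H => H _; apply: H.
  by apply: open_near oA Ax _ => y; apply: fg.
split; first by move=> x /d [dg _]; exact: differentiable_continuous.
split; first by move=> x /d [].
move=> v; apply: IH (H.2 v) => x /d dx; by rewrite (@diff_val _ _ _ _ _ _ _ dx).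
Qed.

(** Lets smoothness be checked with frames that exist only near each point. *)
Lemma Ck_local k A f :
  (forall x, A x -> exists B, [/\ open B, B x & Ck k B f]) -> Ck k A f.
Proof.
elim: k f => [|k IH] f H.
  by split=> // x /H [B [oB Bx [cf _]]]; apply: cf.
split; first by move=> x /H [B [oB Bx [cf _]]]; apply: cf.
split; first by move=> x /H [B [oB Bx [_ [df _]]]]; apply: df.
move=> v; apply: IH => x /H [B [oB Bx [_ [_ Hv]]]]; exists B; split=> //; exact: Hv.
Qed.

(** Replaces ['d f x], known only through its specification, by a formula on A; the
    closure properties below are inductions on k through this lemma. *)
Lemma Ck_intro k A f (df : V -> V -> W) : open A ->
  (forall x, A x -> is_diff x f (df x)) -> (forall v, Ck k A (df^~ v)) -> Ck k.+1 A f.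
Proof.
move=> oA d H; split; first by move=> x /d [dg _]; exact: differentiable_continuous.
split; first by move=> x /d [].
move=> v; apply: Ck_congr (H v) => // x /d dx; by rewrite (@diff_val _ _ _ _ _ _ _ dx).
Qed.

Lemma Ck_is_diff k A f x : Ck k.+1 A f -> A x -> is_diff x f ('d f x).
Proof. by move=> [_ [df _]] Ax; apply: differentiableP; apply: df. Qed.

Lemma Ck_cst k A (a : W) : open A -> Ck k A (fun _ => a).
Proof.
move=> oA; elim: k a => [|k IH] a; first by split=> // x _; exact: cst_continuous.
apply: (Ck_intro (df := fun _ _ => 0)) => // x _; exact: is_diff_cst.
Qed.

Lemma Ck_add k A f g : open A -> Ck k A f -> Ck k A g -> Ck k A (fun x => f x + g x).
Proof.
move=> oA; elim: k f g => [|k IH] f g Hf Hg.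
  split=> // x Ax; apply: cvgD; [exact: (Hf.1 _ Ax)|exact: (Hg.1 _ Ax)].
apply: (Ck_intro (df := fun x v => 'd f x v + 'd g x v)) => //.
  by move=> x Ax; apply: is_diffD; apply: Ck_is_diff Ax; eassumption.
by move=> v; apply: IH; [apply: Hf.2.2 | apply: Hg.2.2].
Qed.

Lemma Ck_sum k A (I : Type) (r : seq I) (P : pred I) (F : I -> V -> W) : open A ->
  (forall i, P i -> Ck k A (F i)) -> Ck k A (fun x => \sum_(i <- r | P i) F i x).
Proof.
move=> oA H; elim: r => [|i r IH].
  by rewrite (_ : (fun _ => _) = fun=> 0); [exact: Ck_cst | apply/funext => x; rewrite big_nil].
case Pi: (P i); last first.
  by rewrite (_ : (fun _ => _) = fun x => \sum_(i <- r | P i) F i x) //;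
     apply/funext => x; rewrite big_cons Pi.
rewrite (_ : (fun _ => _) = fun x => F i x + \sum_(i <- r | P i) F i x).
  by apply: Ck_add => //; apply: H.
by apply/funext => x; rewrite big_cons Pi.
Qed.

Lemma Ck_scalel k A (h : V -> R) (w : W) : open A -> Ck k A h ->
  Ck k A (fun x => h x *: w).
Proof.
move=> oA; elim: k h => [|k IH] h Hh.
  by split=> // x Ax; apply: cvgZr_tmp; apply: (Hh.1 _ Ax).
apply: (Ck_intro (df := fun x v => 'd h x v *: w)) => //.
  move=> x Ax; apply: DiffDef; last by apply: diffZl; apply: Hh.2.1.
  by apply: differentiableZl; apply: Hh.2.1.
by move=> v; apply: IH; apply: Hh.2.2.
Qed.

End Ck_basic.

Section Ck_real.
Implicit Types f g : V -> R.

Lemma Ck_mul k A f g : open A -> Ck k A f -> Ck k A g -> Ck k A (fun x => f x * g x).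
Proof.
move=> oA; elim: k f g => [|k IH] f g Hf Hg.
  by split=> // x Ax; apply: cvgM; [exact: (Hf.1 _ Ax)|exact: (Hg.1 _ Ax)].
apply: (Ck_intro (df := fun x v => f x * 'd g x v + g x * 'd f x v)) => //.
  by move=> x Ax; apply: is_diffM; apply: Ck_is_diff Ax; eassumption.
move=> v; apply: (Ck_add oA); apply: IH.
- exact: CkS.
- exact: (Hg.2.2 v).
- exact: CkS.
- exact: (Hf.2.2 v).
Qed.

Lemma Ck_opp k A f : open A -> Ck k A f -> Ck k A (fun x => - f x).
Proof.
move=> oA Hf; rewrite (_ : (fun _ => _) = fun x => (-1) * f x).
  by apply: Ck_mul => //; apply: Ck_cst.
by apply/funext => x; rewrite mulN1r.
Qed.

Lemma Ck_inv k A f : open A -> (forall x, A x -> f x != 0) -> Ck k A f ->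
  Ck k A (fun x => (f x)^-1).
Proof.
move=> oA f0; elim: k f f0 => [|k IH] f f0 Hf.
  by split=> // x Ax; apply: cvgV; [exact: f0|exact: (Hf.1 _ Ax)].
apply: (Ck_intro (df := fun x v => - ((f x)^-1 * (f x)^-1 * 'd f x v))) => //.
  move=> x Ax; have dfx := Hf.2.1 _ Ax.
  apply: DiffDef; first by apply: differentiableV => //; apply: f0.
  rewrite diffV//; last exact: f0.
  by apply/funext => v /=; rewrite -expr2 exprVn /= scaleNr.
have Hi := IH _ f0 (CkS Hf).
by move=> v; apply: Ck_opp => //; apply: Ck_mul => //; [apply: Ck_mul | apply: Hf.2.2].
Qed.

Lemma Ck_sqrt k A f : open A -> (forall x, A x -> 0 < f x) -> Ck k A f ->
  Ck k A (fun x => Num.sqrt (f x)).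
Proof.
move=> oA f0; elim: k f f0 => [|k IH] f f0 Hf.
  split=> // x Ax; apply: (@cvg_comp _ _ _ f (@Num.sqrt R) _ (nbhs (f x))).
    exact: (Hf.1 _ Ax).
  exact: sqrt_continuous.
apply: (Ck_intro (df := fun x v => (2 * Num.sqrt (f x))^-1 * 'd f x v)) => //.
  move=> x Ax; have dfx := Hf.2.1 _ Ax.
  have ds := @is_derive1_sqrt _ _ (f0 _ Ax).
  have dsq : differentiable (@Num.sqrt R) (f x) by apply/derivable1_diffP; case: ds.
  apply: DiffDef; first exact: differentiable_comp.
  have E : 'd (@Num.sqrt R) (f x) 1 = (2 * Num.sqrt (f x))^-1.
    by rewrite -deriveE//; case: ds.
  apply: eq_trans (diff_comp dfx dsq) _; apply/funext => v.
  transitivity ('d (@Num.sqrt R) (f x) ('d f x v *: (1 : R))).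
    by rewrite /GRing.scale /= mulr1.
  by rewrite linearZ E; exact: mulrC.
have Hi := IH _ f0 (CkS Hf).
move=> v; apply: (Ck_mul oA); last exact: (Hf.2.2 v).
apply: (Ck_inv oA); last exact: (Ck_mul oA (Ck_cst _ _ oA) Hi).
by move=> x Ax; rewrite mulf_neq0 ?pnatr_eq0 // gt_eqF // sqrtr_gt0 f0.
Qed.

End Ck_real.

End Calculus.

Section Rows.
Context {R : realType} {V : normedModType R}.

Lemma is_diff_coord n (f : V -> 'rV[R]_n) x j : differentiable f x ->
  is_diff x (fun y => f y 0 j : R) (fun v => 'd f x v 0 j).
Proof.
move=> df.
pose c := fun N : 'rV[R]_n => N 0 j : R.
have dc : differentiable c (f x) by exact: differentiable_coord.
have lc : linear c by move=> a u v; rewrite /c !mxE.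
have cc : continuous c by exact: coord_continuous.
pose cM := GRing.isLinear.Build _ _ _ _ c lc.
pose cL : {linear 'rV[R]_n -> R} := HB.pack c cM.
apply: DiffDef; first exact: (differentiable_comp df dc).
apply: eq_trans (diff_comp df dc) _.
by have /= -> := (@diff_lin _ _ _ cL (f x) cc).
Qed.

Lemma Ck_coord n k A (f : V -> 'rV[R]_n) j : open A -> Ck k A f ->
  Ck k A (fun x => f x 0 j : R).
Proof.
move=> oA; elim: k f => [|k IH] f Hf.
  split=> // x Ax; apply: (@cvg_comp _ _ _ f (fun N : 'rV[R]_n => N 0 j : R) _ (nbhs (f x))).
    exact: (Hf.1 _ Ax).
  exact: coord_continuous.
apply: (Ck_intro (df := fun x v => 'd f x v 0 j)) => //.
  by move=> x Ax; apply: is_diff_coord; exact: (Hf.2.1 x Ax).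
by move=> v; apply: IH; exact: (Hf.2.2 v).
Qed.

(** A row is the sum of its entries times constant rows. *)
Lemma Ck_row n k A (f : V -> 'rV[R]_n) : open A ->
  (forall j, Ck k A (fun x => f x 0 j : R)) -> Ck k A f.
Proof.
move=> oA H; rewrite (_ : f = fun x => \sum_j f x 0 j *: delta_mx 0 j).
  by apply: Ck_sum => // j _; apply: Ck_scalel.
by apply/funext => x; exact: row_sum_delta.
Qed.

End Rows.

Section Schwarz.
Context {R : realType} {V : normedModType R}.

Lemma is_derive_line (f : V -> R) (x u : V) (s : R) : differentiable f (x + s *: u) ->
  is_derive s 1 (fun t : R => f (x + t *: u)) ('d f (x + s *: u) u).
Proof.
move=> df.
have dl : is_diff s (fun t : R => x + t *: u) (fun t => 0 + t *: u).
  apply: is_diffD.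
have := @is_diff_comp _ _ _ _ (fun t : R => x + t *: u) _ f _ s dl (differentiableP df).
move=> D; have dfl : differentiable (fun t : R => f (x + t *: u)) s by case: D.
apply: DeriveDef; first by apply/derivable1_diffP.
rewrite deriveE //.
have -> : 'd (fun t : R => f (x + t *: u)) s = 'd f (x + s *: u) \o (fun t => 0 + t *: u) :> (R -> R).
  by case: D.
by rewrite /= add0r scale1r.
Qed.

(** The mean value theorem along u, applied to the difference of two translates of f,
    then along v, applied to the derivative in the direction u. *)
Lemma second_difference (f : V -> R) A (x u v : V) (h : R) : 0 < h ->
  Ck 2 A f ->
  (forall s t, 0 <= s <= h -> 0 <= t <= h -> A (x + s *: u + t *: v)) ->
  exists s t, [/\ 0 <= s <= h, 0 <= t <= h &
    f (x + h *: u + h *: v) - f (x + h *: u) - f (x + h *: v) + f x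
    = 'd (fun y => 'd f y u) (x + s *: u + t *: v) v * h * h].
Proof.
move=> h0 [_ [df ddf]] HA.
have hh : 0 <= h <= h by rewrite lexx ltW.
have zh : 0 <= (0 : R) <= h by rewrite lexx ltW.
have seg z : z \in `]0, h[%R -> 0 <= z <= h.
  by rewrite in_itv /= => /andP[a b]; rewrite !ltW.
pose p s := f (x + h *: v + s *: u) - f (x + s *: u).
have Dp s : 0 <= s <= h -> is_derive s 1 p ('d f (x + h *: v + s *: u) u - 'd f (x + s *: u) u).
  move=> hs; apply: is_deriveB; apply: is_derive_line; apply: df.
    by rewrite addrAC; apply: HA.
  by have := HA _ _ hs zh; rewrite scale0r addr0.
have cp : {within `[0, h], continuous p}.
  apply: derivable_within_continuous => s.
  by rewrite in_itv /= => /Dp [].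
have [s s0h Es] := MVT h0 (fun s H => Dp s (seg _ H)) cp.
have sh := seg _ s0h.
pose w t := 'd f (x + s *: u + t *: v) u.
have Dw t : 0 <= t <= h -> is_derive t 1 w ('d (fun y => 'd f y u) (x + s *: u + t *: v) v).
  move=> ht; apply: (is_derive_line (f := fun y => 'd f y u)).
  by have [_ [d _]] := ddf u; apply: d; apply: HA.
have cw : {within `[0, h], continuous w}.
  apply: derivable_within_continuous => t.
  by rewrite in_itv /= => /Dw [].
have [t t0h Et] := MVT h0 (fun s H => Dw s (seg _ H)) cw.
exists s, t; split=> //; first exact: seg.
move: Es Et; rewrite !subr0 /p /w !scale0r !addr0 => Es <-.
rewrite -[x + h *: u + _]addrAC -[x + s *: u + _]addrAC -Es; lra.
Qed.

(** The second difference is symmetric in u and v, and both mixed derivatives are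
    approximated by it divided by h^2. *)
Theorem schwarz (f : V -> R) A (x u v : V) : open A -> A x -> Ck 2 A f ->
  'd (fun y => 'd f y u) x v = 'd (fun y => 'd f y v) x u.
Proof.
move=> oA Ax H2.
have cc a b : {for x, continuous (fun y => 'd (fun y => 'd f y a) y b)}.
  by have [_ [_ H]] := H2; have [_ [_ H']] := H a; apply: (H' b).1.
apply/eqP; rewrite eq_le; apply/andP.
wlog suff : u v / 'd (fun y => 'd f y u) x v <= 'd (fun y => 'd f y v) x u.
  by move=> W; split; apply: W.
apply/ler_addgt0Pr => e e0.
pose e2 := e / 2; have e20 : 0 < e2 by rewrite divr_gt0.
have N : \forall y \near x, [/\ A y,
   'd (fun y => 'd f y u) x v < 'd (fun y => 'd f y u) y v + e2
   & 'd (fun y => 'd f y v) y u < 'd (fun y => 'd f y v) x u + e2].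
  have H1 : \forall y \near x, A y by exact: open_nbhs_nbhs.
  have H3 := cvgr_gt _ (cc u v) ('d (fun y => 'd f y u) x v - e2).
  have H4 := cvgr_lt _ (cc v u) ('d (fun y => 'd f y v) x u + e2).
  near=> y; split; first by near: y.
    by rewrite -ltrBlDr; near: y; apply: H3; rewrite ltrBlDr ltrDl.
  by near: y; apply: H4; rewrite ltrDl.
move/nbhs_ballP: N => [r /= r0 Br].
(* with this K, the points x + s u + t v with s, t <= r / (2 K) stay in the ball of radius r *)
pose K := `|u| + `|v| + 1.
have K0 : 0 < K by rewrite ltr_wpDl // addr_ge0.
pose h := r / 2 / K; have h0 : 0 < h by rewrite !divr_gt0.
have inB s t : 0 <= s <= h -> 0 <= t <= h -> ball x r (x + s *: u + t *: v).
  move=> /andP[s0 sh] /andP[t0 th].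
  rewrite -ball_normE /= -addrA opprD addNKr normrN.
  apply: le_lt_trans (ler_normD _ _) _.
  rewrite !normrZ !ger0_norm //.
  have E : h * K = r / 2 by rewrite /h divfK // gt_eqF.
  have : s * `|u| + t * `|v| <= h * K.
    rewrite /K !mulrDr mulr1 -[leLHS]addr0; apply: lerD; last exact: ltW.
    by apply: lerD; apply: ler_wpM2r.
  move=> /le_lt_trans; apply; rewrite E; lra.
have [s [t [hs ht E1]]] := second_difference (u := u) (v := v) h0 H2
   (fun s t hs ht => let: And3 a _ _ := Br _ (inB s t hs ht) in a).
have inB' s' t' : 0 <= s' <= h -> 0 <= t' <= h -> ball x r (x + s' *: v + t' *: u).
  by move=> ? ?; rewrite addrAC; apply: inB.
have [s' [t' [hs' ht' E2]]] := second_difference (u := v) (v := u) h0 H2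
   (fun s t hs ht => let: And3 a _ _ := Br _ (inB' s t hs ht) in a).
have [_ L1 _] := Br _ (inB _ _ hs ht).
have [_ _ L2] := Br _ (inB' _ _ hs' ht').
have EE : 'd (fun y => 'd f y u) (x + s *: u + t *: v) v
        = 'd (fun y => 'd f y v) (x + s' *: v + t' *: u) u.
  have hh : h * h != 0 by rewrite mulf_neq0 // gt_eqF.
  apply: (mulIf hh); rewrite [LHS]mulrA [RHS]mulrA; apply: etrans (esym E1) (etrans _ E2).
  by rewrite [x + h *: v + _]addrAC; lra.
move: L1 L2; rewrite EE /e2; lra.
Unshelve. all: by end_near. Qed.

End Schwarz.

(** * Matrices of smooth functions *)
Section FunctionAlgebra.
Context {R : realType} {T : Type}.

(** Common interface of the functions of class C^k on an open set of a normed space, of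
    the smooth ones, and of the smooth functions on an open set of a manifold, so that the
    calculus of matrices of functions is done once. *)
Record function_algebra (D : set T) (P : (T -> R) -> Prop) : Prop := FunctionAlgebra {
  fa_cst : forall a, P (fun _ => a);
  fa_add : forall f g, P f -> P g -> P (fun x => f x + g x);
  fa_mul : forall f g, P f -> P g -> P (fun x => f x * g x);
  fa_inv : forall f, (forall x, D x -> f x != 0) -> P f -> P (fun x => (f x)^-1);
  fa_congr : forall f g, (forall x, D x -> f x = g x) -> P f -> P g
}.

Variables (D : set T) (P : (T -> R) -> Prop).
Hypothesis PA : function_algebra D P.

Definition entries m n (A : T -> 'M[R]_(m, n)) := forall i j, P (fun x => A x i j).

Lemma fa_opp f : P f -> P (fun x => - f x).
Proof.
move=> Pf; apply: (fa_congr PA (f := fun x => (-1) * f x)); first by move=> x _; rewrite mulN1r.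
by apply: (fa_mul PA) => //; apply: (fa_cst PA).
Qed.

Lemma fa_sum (I : Type) (r : seq I) (Q : pred I) (F : I -> T -> R) :
  (forall i, P (F i)) -> P (fun x => \sum_(i <- r | Q i) F i x).
Proof.
move=> H; elim: r => [|i r IH].
  apply: (fa_congr PA (f := fun=> 0)); [by move=> x _; rewrite big_nil | exact: (fa_cst PA)].
apply: (fa_congr PA (f := fun x => (Q i)%:R * F i x + \sum_(i <- r | Q i) F i x)).
  by move=> x _; rewrite big_cons; case: (Q i); rewrite ?mul1r // mul0r add0r.
by apply: (fa_add PA) => //; apply: (fa_mul PA) => //; apply: (fa_cst PA).
Qed.

Lemma fa_prod (I : Type) (r : seq I) (Q : pred I) (F : I -> T -> R) :
  (forall i, P (F i)) -> P (fun x => \prod_(i <- r | Q i) F i x).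
Proof.
move=> H; elim: r => [|i r IH].
  apply: (fa_congr PA (f := fun=> 1)); [by move=> x _; rewrite big_nil | exact: (fa_cst PA)].
apply: (fa_congr PA (f := fun x => (if Q i then F i x else 1) * \prod_(i <- r | Q i) F i x)).
  by move=> x _; rewrite big_cons; case: (Q i); rewrite ?mul1r.
by apply: (fa_mul PA) => //; case: (Q i) => //; apply: (fa_cst PA).
Qed.

Lemma entries_congr m n (A B : T -> 'M[R]_(m, n)) :
  (forall x, D x -> A x = B x) -> entries A -> entries B.
Proof. by move=> AB HA i j; apply: (fa_congr PA _ (HA i j)) => x /AB ->. Qed.

Lemma entries_cst m n (A : 'M[R]_(m, n)) : entries (fun _ => A).
Proof. by move=> i j; apply: (fa_cst PA). Qed.

Lemma entries_add m n (A B : T -> 'M[R]_(m, n)) :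
  entries A -> entries B -> entries (fun x => A x + B x).
Proof.
move=> HA HB i j; apply: (fa_congr PA (f := fun x => A x i j + B x i j)); last exact: (fa_add PA).
by move=> x _; rewrite mxE.
Qed.

Lemma entries_opp m n (A : T -> 'M[R]_(m, n)) : entries A -> entries (fun x => - A x).
Proof.
move=> HA i j; apply: (fa_congr PA (f := fun x => - A x i j)); last exact: fa_opp.
by move=> x _; rewrite mxE.
Qed.

Lemma entries_scale m n f (A : T -> 'M[R]_(m, n)) :
  P f -> entries A -> entries (fun x => f x *: A x).
Proof.
move=> Pf HA i j; apply: (fa_congr PA (f := fun x => f x * A x i j)); last exact: (fa_mul PA).
by move=> x _; rewrite mxE.
Qed.

Lemma entries_mul m n p (A : T -> 'M[R]_(m, n)) (B : T -> 'M[R]_(n, p)) :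
  entries A -> entries B -> entries (fun x => A x *m B x).
Proof.
move=> HA HB i j; apply: (fa_congr PA (f := fun x => \sum_k A x i k * B x k j)).
  by move=> x _; rewrite mxE.
by apply: fa_sum => k; apply: (fa_mul PA).
Qed.

Lemma entries_tr m n (A : T -> 'M[R]_(m, n)) : entries A -> entries (fun x => (A x)^T).
Proof.
by move=> HA i j; apply: (fa_congr PA (f := fun x => A x j i)) => // x _; rewrite mxE.
Qed.

Lemma entries_det n (A : T -> 'M[R]_n) : entries A -> P (fun x => \det (A x)).
Proof.
move=> HA; apply: fa_sum => s; apply: (fa_mul PA); first exact: (fa_cst PA).
exact: fa_prod.
Qed.

(** By Cramer's rule, the inverse is a polynomial in the entries divided by the
    determinant. *)
Lemma entries_inv n (A : T -> 'M[R]_n) : (forall x, D x -> A x \in unitmx) ->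
  entries A -> entries (fun x => invmx (A x)).
Proof.
move=> uA HA.
apply: (entries_congr (A := fun x => (\det (A x))^-1 *: \adj (A x))).
  by move=> x /uA Ax; rewrite /invmx Ax.
apply: entries_scale.
  by apply: (fa_inv PA); [move=> x /uA; rewrite unitmxE unitfE | exact: entries_det].
move=> i j; apply: (fa_congr PA (f := fun x => cofactor (A x) j i)).
  by move=> x _; rewrite !mxE.
apply: (fa_mul PA); first exact: (fa_cst PA).
apply: entries_det => k l.
by apply: (fa_congr PA (f := fun x => A x (lift j k) (lift i l))) => // x _; rewrite !mxE.
Qed.

End FunctionAlgebra.

Lemma Ck_algebra (R : realType) (V : normedModType R) (A : set V) k : open A ->
  function_algebra A (fun f : V -> R => Ck k A f).
Proof.
move=> oA; split.
- by move=> a; apply: Ck_cst.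
- by move=> f g; apply: Ck_add.
- by move=> f g; apply: Ck_mul.
- by move=> f; apply: Ck_inv.
- by move=> f g; apply: Ck_congr.
Qed.

Lemma smooth_algebra (R : realType) (V : normedModType R) (A : set V) : open A ->
  function_algebra A (fun f : V -> R => smooth A f).
Proof.
move=> oA; split.
- by move=> a k; apply: (fa_cst (Ck_algebra k oA)).
- by move=> f g Hf Hg k; apply: (fa_add (Ck_algebra k oA)).
- by move=> f g Hf Hg k; apply: (fa_mul (Ck_algebra k oA)).
- by move=> f f0 Hf k; apply: (fa_inv (Ck_algebra k oA)).
- by move=> f g fg Hf k; apply: (fa_congr (Ck_algebra k oA) fg).
Qed.

Section MatrixCalculus.
Context {R : realType} {n0 : nat}.
Notation V := 'rV[R]_n0.
Implicit Types (x v : V).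

Definition mx_deriv m n (A : V -> 'M[R]_(m, n)) x v : 'M[R]_(m, n) :=
  \matrix_(i, j) 'd (fun y => A y i j : R) x v.

Definition mx_differentiable m n (A : V -> 'M[R]_(m, n)) x : Prop :=
  forall i j, differentiable (fun y => A y i j : R) x.

Lemma diff_rowE (f : V -> R) x v : 'd f x v = \sum_i v 0 i * ('d f x (delta_mx 0 i)).
Proof.
rewrite {1}[v]row_sum_delta linear_sum; apply: eq_bigr => i _.
by rewrite linearZ.
Qed.

Lemma mx_deriv_near m n (A B : V -> 'M[R]_(m, n)) x v :
  (\forall y \near x, A y = B y) -> mx_differentiable A x -> mx_deriv B x v = mx_deriv A x v.
Proof.
move=> AB dA; apply/matrixP => i j; rewrite [LHS]mxE [RHS]mxE.
have E : \forall y \near x, A y i j = B y i j by apply: filterS AB => y ->.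
have [_ H] := near_eq_diff E (dA i j); exact: (congr1 (@^~ v) H).
Qed.

Lemma mx_deriv_linear m n (A : V -> 'M[R]_(m, n)) x : linear (mx_deriv A x).
Proof. by move=> a u v; apply/matrixP => i j; rewrite !mxE linearP. Qed.

Lemma mx_deriv_cst m n (A : 'M[R]_(m, n)) x v : mx_deriv (fun _ => A) x v = 0.
Proof.
by apply/matrixP => i j; rewrite !mxE; have /= -> := diff_cst (V := V) (A i j) x.
Qed.

Lemma is_diff_ext (f g df dg : V -> R) x : is_diff x f df ->
  (forall y, g y = f y) -> (forall v, dg v = df v) -> is_diff x g dg.
Proof. by move=> H /funext -> /funext ->. Qed.

Lemma is_diff_sum (I : Type) (r : seq I) (F dF : I -> V -> R) x :
  (forall i, is_diff x (F i) (dF i)) ->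
  is_diff x (fun y => \sum_(i <- r) F i y) (fun v => \sum_(i <- r) dF i v).
Proof.
move=> H; elim: r => [|i r IH].
  by apply: is_diff_ext (is_diff_cst (0 : R) x) _ _ => y; rewrite big_nil.
by apply: is_diff_ext (is_diffD (H i) IH) _ _ => y; rewrite big_cons.
Qed.

Lemma is_diff_mul (f g df dg : V -> R) x : is_diff x f df -> is_diff x g dg ->
  is_diff x (fun y => f y * g y) (fun v => df v * g x + f x * dg v).
Proof.
move=> Hf Hg; apply: is_diff_ext (is_diffM Hf Hg) _ _ => // v.
by rewrite addrC !fctE [df v * _]mulrC.
Qed.

Lemma is_diff_mulmx m n p (A : V -> 'M[R]_(m, n)) (B : V -> 'M[R]_(n, p)) x i j :
  mx_differentiable A x -> mx_differentiable B x ->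
  is_diff x (fun y => (A y *m B y) i j : R)
            (fun v => (mx_deriv A x v *m B x + A x *m mx_deriv B x v) i j).
Proof.
move=> dA dB.
apply: (is_diff_ext (f := fun y => \sum_k A y i k * B y k j)
  (df := fun v => \sum_k (mx_deriv A x v i k * B x k j + A x i k * mx_deriv B x v k j))).
- apply: is_diff_sum => k; apply: is_diff_mul.
    by apply: is_diff_ext (differentiableP (dA i k)) _ _ => // v; rewrite mxE.
  by apply: is_diff_ext (differentiableP (dB k j)) _ _ => // v; rewrite mxE.
- by move=> y; rewrite mxE.
- by move=> v; rewrite !mxE -big_split.
Qed.

Lemma mx_differentiable_mul m n p (A : V -> 'M[R]_(m, n)) (B : V -> 'M[R]_(n, p)) x :
  mx_differentiable A x -> mx_differentiable B x -> mx_differentiable (fun y => A y *m B y) x.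
Proof. by move=> dA dB i j; case: (is_diff_mulmx i j dA dB). Qed.

Lemma mx_deriv_mul m n p (A : V -> 'M[R]_(m, n)) (B : V -> 'M[R]_(n, p)) x v :
  mx_differentiable A x -> mx_differentiable B x ->
  mx_deriv (fun y => A y *m B y) x v = mx_deriv A x v *m B x + A x *m mx_deriv B x v.
Proof.
move=> dA dB; apply/matrixP => i j; rewrite [LHS]mxE.
by have [_ ->] := is_diff_mulmx i j dA dB.
Qed.

Lemma mx_deriv_tr m n (A : V -> 'M[R]_(m, n)) x v : mx_deriv (fun y => (A y)^T) x v = (mx_deriv A x v)^T.
Proof.
apply/matrixP => i j; rewrite !mxE; congr ('d _ x v).
by apply/funext => y; rewrite mxE.
Qed.

Lemma is_diff_prod (I : eqType) (r : seq I) (F dF : I -> V -> R) x : uniq r ->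
  (forall i, is_diff x (F i) (dF i)) ->
  is_diff x (fun y => \prod_(i <- r) F i y)
    (fun v => \sum_(i <- r) \prod_(j <- r) (if j == i then dF j v else F j x)).
Proof.
elim: r => [|i r IH] /=.
  by move=> _ H; apply: is_diff_ext (is_diff_cst (1 : R) x) _ _ => y; rewrite big_nil.
move=> /andP[ir ur] H.
apply: is_diff_ext (is_diff_mul (H i) (IH ur H)) _ _ => [y|v]; first by rewrite big_cons.
rewrite big_cons big_cons eqxx; congr (_ * _ + _).
  rewrite big_seq [RHS]big_seq; apply: eq_bigr => j jr.
  by case: eqP => // ji; rewrite -ji jr in ir.
rewrite big_distrr big_seq [RHS]big_seq; apply: eq_bigr => j jr.
rewrite big_cons; case: eqP => // ij; by rewrite ij jr in ir.
Qed.

Definition subst_row n (M N : 'M[R]_n) (i : 'I_n) : 'M[R]_n :=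
  \matrix_(k, l) if k == i then N k l else M k l.

(** Laplace expansion of each determinant along its new row. *)
Lemma det_subst_row n (M N : 'M[R]_n) :
  \sum_i \det (subst_row M N i) = \tr (N *m \adj M).
Proof.
apply: eq_bigr => i _; rewrite (expand_det_row _ i) mxE.
apply: eq_bigr => j _; rewrite !mxE eqxx; congr (_ * _).
congr (_ * \det _); apply/matrixP => k l; rewrite !mxE.
by rewrite eq_sym (negbTE (neq_lift _ _)).
Qed.

(** Jacobi's formula, from the Leibniz rule applied to the product of entries attached to
    each permutation. *)
Lemma is_diff_det n (A : V -> 'M[R]_n) x : mx_differentiable A x ->
  is_diff x (fun y => \det (A y)) (fun v => \tr (mx_deriv A x v *m \adj (A x))).
Proof.
move=> dA.
apply: (is_diff_ext (f := fun y => \sum_(s : 'S_n) (-1) ^+ s * \prod_i A y i (s i))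
  (df := fun v => \sum_(s : 'S_n) ((-1) ^+ s *
   \sum_i \prod_j (if j == i then mx_deriv A x v j (s j) else A x j (s j))))).
- apply: is_diff_sum => s.
  have E : is_diff x (fun y => \prod_i A y i (s i))
      (fun v => \sum_i \prod_j (if j == i then mx_deriv A x v j (s j) else A x j (s j))).
    apply: (is_diff_prod (F := fun i y => A y i (s i)) (dF := fun i v => mx_deriv A x v i (s i))).
      exact: index_enum_uniq.
    move=> i; apply: is_diff_ext (differentiableP (dA i (s i))) _ _ => // v.
    by rewrite mxE.
  exact: is_diffZ.
- by [].
- move=> v; rewrite -det_subst_row /determinant exchange_big /=.
  apply: eq_bigr => s _; rewrite big_distrr; apply: eq_bigr => i _ /=; congr (_ * _).
  by apply: eq_bigr => j _; rewrite !mxE.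
Qed.

Definition jac_mx (Z : V -> V) x : 'M[R]_n0 :=
  \matrix_(i, j) 'd (fun y => Z y 0 j : R) x (delta_mx 0 i).

Lemma mx_deriv_jac (Z : V -> V) x v : mx_deriv Z x v = v *m jac_mx Z x.
Proof.
apply/matrixP => i j; rewrite !mxE ord1 diff_rowE.
by apply: eq_bigr => k _; rewrite !mxE.
Qed.

Lemma smooth_mx_differentiable m n (A : V -> 'M[R]_(m, n)) (O : set V) x :
  entries (fun f : V -> R => smooth O f) A -> O x -> mx_differentiable A x.
Proof. by move=> H Ox i j; case: (H i j 1%N) => _ [] /(_ x Ox). Qed.

(** The derivative along a vector field is a combination, with smooth coefficients, of the
    partial derivatives, which are smooth by definition of the class C^(k+1). *)
Lemma smooth_dir (O : set V) (f : V -> R) (u : V -> V) : open O ->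
  smooth O f -> entries (fun f : V -> R => smooth O f) u ->
  smooth O (fun x => 'd f x (u x)).
Proof.
move=> oO Hf Hu; apply: (fa_congr (smooth_algebra oO)
  (f := fun x => \sum_i u x 0 i * ('d f x (delta_mx 0 i)))).
  by move=> x _; rewrite -diff_rowE.
apply: (fa_sum (smooth_algebra oO)) => i; apply: (fa_mul (smooth_algebra oO)) => //.
by move=> k; have [_ [_ H]] := Hf k.+1; exact: (H (delta_mx 0 i)).
Qed.

Lemma smooth_mx_deriv m n (O : set V) (A : V -> 'M[R]_(m, n)) (u : V -> V) : open O ->
  entries (fun f : V -> R => smooth O f) A -> entries (fun f : V -> R => smooth O f) u ->
  entries (fun f : V -> R => smooth O f) (fun x => mx_deriv A x (u x)).
Proof.
move=> oO Hf Hu i j.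
apply: (fa_congr (smooth_algebra oO) (f := fun x => 'd (fun y => A y i j : R) x (u x))).
  by move=> x _; rewrite mxE.
exact: smooth_dir.
Qed.

Lemma smooth_jac (O : set V) (Z : V -> V) : open O ->
  entries (fun f : V -> R => smooth O f) Z -> entries (fun f : V -> R => smooth O f) (jac_mx Z).
Proof.
move=> oO HZ i j.
apply: (fa_congr (smooth_algebra oO) (f := fun x => 'd (fun y => Z y 0 j : R) x (delta_mx 0 i))).
  by move=> x _; rewrite mxE.
by move=> k; have [_ [_ H]] := HZ 0 j k.+1; exact: (H (delta_mx 0 i)).
Qed.

End MatrixCalculus.

(** * Linear algebra of one tangent space *)
Section Orthogonality.
Context {R : fieldType} {n : nat}.
Variable G : 'M[R]_n.
Hypotheses (Gsym : G^T = G) (Gunit : G \in unitmx).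

Definition orth_mx m (D : 'M[R]_(m, n)) : 'M[R]_n := kermx (G *m D^T).

Lemma sub_orth_mx k m (u : 'M[R]_(k, n)) (D : 'M[R]_(m, n)) :
  (u <= orth_mx D)%MS = (u *m G *m D^T == 0).
Proof. by rewrite sub_kermx mulmxA. Qed.

Lemma orth_mx_sym k m (u : 'M[R]_(k, n)) (D : 'M[R]_(m, n)) :
  (u <= orth_mx D)%MS = (D <= orth_mx u)%MS.
Proof.
rewrite !sub_orth_mx -(inj_eq (@trmx_inj _ _ _)) trmx0.
by rewrite !trmx_mul trmxK Gsym mulmxA.
Qed.

Lemma gram_tr k m (A : 'M[R]_(k, n)) (B : 'M[R]_(m, n)) :
  (A *m G *m B^T)^T = B *m G *m A^T.
Proof. by rewrite !trmx_mul trmxK Gsym mulmxA. Qed.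

Lemma orth_mx_eq0 k m (u : 'M[R]_(k, n)) (D : 'M[R]_(m, n)) :
  (u <= orth_mx D)%MS -> u *m G *m D^T = 0.
Proof. by rewrite sub_orth_mx => /eqP. Qed.

Lemma orth_mxS k m (A : 'M[R]_(k, n)) (B : 'M[R]_(m, n)) :
  (A <= B)%MS -> (orth_mx B <= orth_mx A)%MS.
Proof. by move=> AB; rewrite orth_mx_sym (submx_trans AB) // orth_mx_sym. Qed.

Lemma orth_mx_adds k l m (u : 'M[R]_(k, n)) (A : 'M[R]_(l, n)) (B : 'M[R]_(m, n)) :
  (u <= orth_mx (A + B)%MS)%MS = (u <= orth_mx A)%MS && (u <= orth_mx B)%MS.
Proof. by rewrite orth_mx_sym addsmx_sub -!(orth_mx_sym u). Qed.

Lemma orth_mx_eq k m (A : 'M[R]_(k, n)) (B : 'M[R]_(m, n)) :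
  (A :=: B)%MS -> (orth_mx A :=: orth_mx B)%MS.
Proof. by move=> AB; apply/eqmxP; rewrite !orth_mxS // AB. Qed.

Lemma mxrank_orth_mx m (D : 'M[R]_(m, n)) : \rank (orth_mx D) = (n - \rank D)%N.
Proof.
rewrite mxrank_ker; congr (_ - _)%N.
by rewrite (eqmxMfull _ _) ?mxrank_tr // row_full_unit.
Qed.

(** One inclusion is the symmetry of orthogonality; the ranks agree. *)
Lemma orth_mxK m (D : 'M[R]_(m, n)) : (orth_mx (orth_mx D) :=: D)%MS.
Proof.
apply: eqmx_sym; apply/eqmxP.
have le : (D <= orth_mx (orth_mx D))%MS by rewrite orth_mx_sym.
rewrite le /= -(geq_leqif (mxrank_leqif_sup le)) !mxrank_orth_mx subKn //.
exact: rank_leq_col.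
Qed.

End Orthogonality.

(** The vectors N_i as the rows of one matrix: the rows of U are the vectors of the span
    of V dual to xi, and the correction along xi makes them isotropic. *)
Definition null_mx (R : realFieldType) r n (G : 'M[R]_n) (xi V : 'M[R]_(r, n)) : 'M[R]_(r, n) :=
  let U := (invmx (xi *m G *m V^T))^T *m V in
  U - 2^-1 *: (U *m G *m U^T) *m xi.

(** The covectors g(., N_i) and, when D is the diagonal of signs, eps_a g(., X_a). *)
Definition adapted_coframe (R : realFieldType) n r s (G : 'M[R]_n) (N : 'M[R]_(r, n))
    (X : 'M[R]_(s, n)) (D : 'M[R]_s) : 'M[R]_(n, r + s) :=
  row_mx (G *m N^T) (G *m X^T *m D).

(** What the screens, the radical and E become in one tangent space with Gram matrix G. *)
Record lightlike_splitting (R : realFieldType) n (G TF S S' E Rad : 'M[R]_n) : Prop := {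
  ls_sym : G^T = G;
  ls_unit : G \in unitmx;
  ls_Rad : Rad = (TF :&: orth_mx G TF)%MS;
  ls_TF : (TF :=: S + Rad)%MS;
  ls_S : (S :&: Rad)%MS = 0;
  ls_TFo : (orth_mx G TF :=: S' + Rad)%MS;
  ls_S' : (S' :&: Rad)%MS = 0;
  ls_E : (orth_mx G S :&: orth_mx G S' :=: Rad + E)%MS
}.

Section LightlikeAlgebra.
Context {R : realFieldType} {n r s : nat} {G TF S S' E Rad : 'M[R]_n}.
Hypothesis hls : lightlike_splitting G TF S S' E Rad.
Local Notation orth_ A := (orth_mx G A%MS).

Let Gsym := ls_sym hls.
Let Gunit := ls_unit hls.
Let defRad := ls_Rad hls.
Let TFE := ls_TF hls.
Let SRad := ls_S hls.
Let TFoE := ls_TFo hls.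
Let S'Rad := ls_S' hls.
Let soE := ls_E hls.
Let S_TF : (S <= TF)%MS. Proof. by rewrite TFE addsmxSl. Qed.
Let S'_TFo : (S' <= orth_ TF)%MS. Proof. by rewrite TFoE addsmxSl. Qed.
Let Rad_TF : (Rad <= TF)%MS. Proof. by rewrite defRad capmxSl. Qed.
Let Rad_TFo : (Rad <= orth_ TF)%MS. Proof. by rewrite defRad capmxSr. Qed.

Lemma S_orth_S' : (S <= orth_ S')%MS.
Proof. by rewrite orth_mx_sym // (submx_trans S'_TFo) // orth_mxS. Qed.

Lemma Rad_orth_S : (Rad <= orth_ S)%MS.
Proof. by apply: submx_trans Rad_TFo _; rewrite orth_mxS. Qed.

Lemma Rad_orth_S' : (Rad <= orth_ S')%MS.
Proof. by rewrite orth_mx_sym // (submx_trans S'_TFo) // orth_mxS. Qed.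

(** A vector of S orthogonal to S is orthogonal to S + Rad = TF, hence lies in Rad. *)
Lemma S_nondeg k (v : 'M[R]_(k, n)) : (v <= S)%MS -> (v <= orth_ S)%MS -> v = 0.
Proof.
move=> vS vSo; apply/eqP; rewrite -submx0 -SRad sub_capmx vS defRad sub_capmx.
rewrite (submx_trans vS S_TF) /= (orth_mx_eq Gsym TFE) orth_mx_adds // vSo /=.
by rewrite orth_mx_sym // (submx_trans Rad_orth_S) // orth_mxS.
Qed.

(** A vector of S' orthogonal to S' is orthogonal to the orthogonal complement of TF,
    hence lies in TF by biduality, and so in Rad. *)
Lemma S'_nondeg k (v : 'M[R]_(k, n)) : (v <= S')%MS -> (v <= orth_ S')%MS -> v = 0.
Proof.
move=> vS vSo; apply/eqP; rewrite -submx0 -S'Rad sub_capmx vS defRad sub_capmx andbC.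
rewrite (submx_trans vS S'_TFo) /= -(orth_mxK Gsym Gunit TF) (orth_mx_eq Gsym TFoE).
rewrite orth_mx_adds // vSo /=.
by rewrite orth_mx_sym // (submx_trans Rad_orth_S') // orth_mxS.
Qed.

Lemma S_gram_unit k (B : 'M[R]_(k, n)) : row_free B -> (B :=: S)%MS ->
  B *m G *m B^T \in unitmx.
Proof.
move=> fB BS; rewrite -row_free_unit -kermx_eq0; apply/rowV0P => a /sub_kermxP aB.
apply/eqP; rewrite -(mulmx_free_eq0 _ fB); apply/eqP; apply: S_nondeg.
  by rewrite -BS submxMl.
by rewrite -(orth_mx_eq Gsym BS) sub_orth_mx -aB !mulmxA.
Qed.

Lemma S'_gram_unit k (B : 'M[R]_(k, n)) : row_free B -> (B :=: S')%MS ->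
  B *m G *m B^T \in unitmx.
Proof.
move=> fB BS; rewrite -row_free_unit -kermx_eq0; apply/rowV0P => a /sub_kermxP aB.
apply/eqP; rewrite -(mulmx_free_eq0 _ fB); apply/eqP; apply: S'_nondeg.
  by rewrite -BS submxMl.
by rewrite -(orth_mx_eq Gsym BS) sub_orth_mx -aB !mulmxA.
Qed.

Variables (xi V : 'M[R]_(r, n)).
Hypotheses (xi_free : row_free xi) (xiE : (xi :=: Rad)%MS).
Hypothesis VE : (V :=: E)%MS.

Let xi_Rad : (xi <= Rad)%MS. Proof. by rewrite xiE. Qed.

(** A combination v of the xi_j orthogonal to E is orthogonal to Rad + E, which is the
    orthogonal complement of S + S'; so v lies in S + S'.  Being itself orthogonal to S and
    to S', it vanishes by the nondegeneracy of S and S'. *)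
Lemma pairing_unit : xi *m G *m V^T \in unitmx.
Proof.
rewrite -row_free_unit -kermx_eq0; apply/rowV0P => a /sub_kermxP aG.
apply/eqP; rewrite -(mulmx_free_eq0 _ xi_free); apply/eqP.
set v := a *m xi.
have vRad : (v <= Rad)%MS by rewrite -xiE submxMl.
have vE : (v <= orth_ E)%MS by rewrite -(orth_mx_eq Gsym VE) sub_orth_mx -aG !mulmxA.
have vo : (v <= orth_ (Rad + E))%MS.
  by rewrite orth_mx_adds // vE andbT (submx_trans vRad) // (submx_trans Rad_TFo) // orth_mxS.
have SS' : (orth_ (S + S') <= Rad + E)%MS.
  by rewrite -soE sub_capmx -orth_mx_adds.
have : (v <= S + S')%MS.
  by rewrite -(orth_mxK Gsym Gunit (S + S')%MS) (submx_trans vo) // orth_mxS.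
case/sub_addsmxP => -[a1 a2] /= vE2.
have a1S : a1 *m S = 0.
  apply: S_nondeg; first exact: submxMl.
  have -> : a1 *m S = v - a2 *m S' by rewrite vE2 addrK.
  rewrite addmx_sub ?(submx_trans vRad Rad_orth_S) //.
  by rewrite eqmx_opp (submx_trans (submxMl _ _)) // orth_mx_sym // S_orth_S'.
rewrite a1S add0r in vE2; rewrite vE2; apply: S'_nondeg; first exact: submxMl.
by rewrite -vE2 (submx_trans vRad Rad_orth_S').
Qed.

Let H := invmx (xi *m G *m V^T).
Let U := H^T *m V.
Let N := null_mx G xi V.

Let xiGxi : xi *m G *m xi^T = 0.
Proof.
apply/eqP; rewrite -sub_orth_mx xiE (submx_trans Rad_TFo) // orth_mxS //.
by rewrite xiE.
Qed.

Let xiGU : xi *m G *m U^T = 1%:M.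
Proof. by rewrite trmx_mul trmxK mulmxA mulmxV // pairing_unit. Qed.

Let UGxi : U *m G *m xi^T = 1%:M.
Proof. by rewrite -[LHS]trmxK (gram_tr Gsym) xiGU trmx1. Qed.

Let UE : (U <= E)%MS. Proof. by rewrite -VE submxMl. Qed.

Lemma xi_G_null : xi *m G *m N^T = 1%:M.
Proof.
by rewrite /N /null_mx -/H -/U linearB /= mulmxBr xiGU trmx_mul mulmxA xiGxi mul0mx subr0.
Qed.

Lemma null_G_xi : N *m G *m xi^T = 1%:M.
Proof. by rewrite -[LHS]trmxK (gram_tr Gsym) xi_G_null trmx1. Qed.

(** Each of the two cross terms contributes minus half of the Gram matrix of U, and the
    term quadratic in xi is zero. *)
Lemma null_isotropic : N *m G *m N^T = 0.
Proof.
have -> : N = U - 2^-1 *: (U *m G *m U^T) *m xi by [].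
set K := 2^-1 *: _.
have KT : K^T = K by rewrite linearZ /= (gram_tr Gsym).
rewrite linearB /= [(K *m xi)^T]trmx_mul KT !(mulmxBl, mulmxBr).
rewrite [U *m G *m (xi^T *m K)]mulmxA UGxi mul1mx.
have -> : K *m xi *m G *m U^T = K by rewrite -!mulmxA [xi *m _]mulmxA xiGU mulmx1.
have -> : K *m xi *m G *m (xi^T *m K) = 0.
  by rewrite mulmxA -[K *m xi *m G *m _]mulmxA -!mulmxA [xi *m
    (G *m _)]mulmxA [xi *m G *m _]mulmxA xiGxi mul0mx mulmx0.
rewrite subr0 -addrA -opprD -scalerDl.
have -> : 2^-1 + 2^-1 = 1 :> R by lra.
by rewrite scale1r subrr.
Qed.

Let null_sub : (N <= Rad + E)%MS.
Proof.
apply: addmx_sub; first by rewrite (submx_trans UE) // addsmxSr.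
by rewrite eqmx_opp (submx_trans (submxMl _ _)) // (submx_trans xi_Rad) // addsmxSl.
Qed.

Lemma null_orth_S : (N <= orth_ S)%MS.
Proof. by rewrite (submx_trans null_sub) // -soE capmxSl. Qed.

Lemma null_orth_S' : (N <= orth_ S')%MS.
Proof. by rewrite (submx_trans null_sub) // -soE capmxSr. Qed.

Variables (X : 'M[R]_(s, n)) (D : 'M[R]_s).
Hypotheses (XS : (X :=: S)%MS) (XD : X *m G *m X^T = D) (DD : D *m D = 1%:M).

Let Th := adapted_coframe G N X D.
Let B := col_mx xi X.

Lemma frame_coframe : B *m Th = 1%:M.
Proof.
rewrite mul_col_row !mulmxA xi_G_null XD DD.
have -> : xi *m G *m X^T = 0.
  by apply: orth_mx_eq0; rewrite (submx_trans xi_Rad) // (orth_mx_eq Gsym XS) Rad_orth_S.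
have -> : X *m G *m N^T = 0 by apply: orth_mx_eq0;
  rewrite orth_mx_sym // (orth_mx_eq Gsym XS) null_orth_S.
by rewrite mul0mx -scalar_mx_block.
Qed.

Lemma frame_TF : (B :=: TF)%MS.
Proof.
apply: eqmx_trans (eqmx_sym (addsmxE _ _)) _; apply: eqmx_trans _ (eqmx_sym TFE).
by apply: eqmx_trans (adds_eqmx xiE XS) _; rewrite addsmxC.
Qed.

(** If v is annihilated by the coframe, then v - sum_i g(v, xi_i) N_i is orthogonal to TF
    and to the N_i; it lies in S' + Rad, and pairing with the N_i kills its component in
    Rad. *)
Lemma coframe_kernel k (v : 'M[R]_(k, n)) :
  (v *m Th == 0) = (v <= N + S')%MS.
Proof.
apply/eqP/idP => [|vN].
  rewrite mul_mx_row => vT.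
  have vN : v *m (G *m N^T) = 0 by rewrite -[LHS](row_mxKl _ (v *m (G *m X^T *m D))) vT linear0.
  have vXD : v *m (G *m X^T *m D) = 0 by rewrite -[LHS](row_mxKr (v *m (G *m N^T))) vT linear0.
  have vX : v *m G *m X^T = 0.
    by rewrite -[LHS]mulmx1 -DD mulmxA -[v *m G *m _]mulmxA -[v *m _ *m D]mulmxA vXD mul0mx.
  rewrite mulmxA in vN.
  set c := v *m G *m xi^T; pose w := v - c *m N.
  have wxi : w *m G *m xi^T = 0.
    by rewrite !mulmxBl -[c *m N *m G]mulmxA -[c *m _ *m _]mulmxA null_G_xi mulmx1 subrr.
  have wX : (w <= orth_ X)%MS.
    rewrite addmx_sub //; first by rewrite sub_orth_mx vX.
    by rewrite eqmx_opp (submx_trans (submxMl _ _)) // (orth_mx_eq Gsym XS) null_orth_S.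
  have wN : w *m G *m N^T = 0.
    by rewrite !mulmxBl vN -[c *m N *m G]mulmxA -[c *m _ *m _]mulmxA null_isotropic mulmx0 subr0.
  have : (w <= S' + Rad)%MS.
    rewrite -TFoE (orth_mx_eq Gsym (eqmx_sym frame_TF)).
    by rewrite -(orth_mx_eq Gsym (addsmxE _ _)) orth_mx_adds // wX sub_orth_mx wxi eqxx.
  rewrite -(adds_eqmx (eqmx_refl S') xiE) => /sub_addsmxP [[a1 a2] /= wE].
  have a2E : a2 = 0.
    have := wN; rewrite wE !mulmxDl -[a2 *m xi *m G]mulmxA -[a2 *m _ *m _]mulmxA xi_G_null mulmx1.
    suff -> : a1 *m S' *m G *m N^T = 0 by rewrite add0r.
    by apply: orth_mx_eq0; rewrite (submx_trans (submxMl _ _)) // orth_mx_sym // null_orth_S'.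
  have -> : v = c *m N + a1 *m S' by rewrite -[LHS](subrK (c *m N)) -/w wE a2E mul0mx addr0 addrC.
  exact: addmx_sub_adds (submxMl _ _) (submxMl _ _).
rewrite mul_mx_row !mulmxA.
have -> : v *m G *m N^T = 0.
  apply: orth_mx_eq0; rewrite (submx_trans vN) // addsmx_sub sub_orth_mx null_isotropic eqxx /=.
  by rewrite orth_mx_sym // null_orth_S'.
have -> : v *m G *m X^T = 0.
  apply: orth_mx_eq0; rewrite (submx_trans vN) // (orth_mx_eq Gsym XS) addsmx_sub null_orth_S /=.
  by rewrite orth_mx_sym // S_orth_S'.
by rewrite mul0mx row_mx0.
Qed.

(** Adding the squares of the lambda^i to the metric makes xi orthonormal without changing
    the products with X; the new form does not involve X. *)
Lemma frame_gram :
  B *m (G + G *m N^T *m (G *m N^T)^T) *m B^T = block_mx 1%:M 0 0 D.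
Proof.
have NX : N *m G *m X^T = 0 by apply: orth_mx_eq0; rewrite (orth_mx_eq Gsym XS) null_orth_S.
have XN : X *m G *m N^T = 0 by rewrite -[LHS]trmxK (gram_tr Gsym) NX trmx0.
have xX : xi *m G *m X^T = 0.
  by apply: orth_mx_eq0; rewrite (submx_trans xi_Rad) // (orth_mx_eq Gsym XS) Rad_orth_S.
have Xx : X *m G *m xi^T = 0 by rewrite -[LHS]trmxK (gram_tr Gsym) xX trmx0.
have BN : B *m (G *m N^T) = col_mx 1%:M 0.
  by rewrite mul_col_mx !mulmxA xi_G_null XN.
have BWW (W : 'M[R]_(n, r)) : B *m (W *m W^T) *m B^T = B *m W *m (B *m W)^T.
  by rewrite trmx_mul !mulmxA.
rewrite mulmxDr mulmxDl BWW BN /B mul_col_mx tr_col_mx mul_col_row xiGxi xX Xx XD.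
rewrite tr_col_mx mul_col_row trmx0 trmx1 !mulmx0 !mul0mx mulmx1.
by rewrite add_block_mx add0r !addr0.
Qed.

End LightlikeAlgebra.

(** Only the dual basis H^T V enters the formula, and a change of basis of the span of V
    cancels in it. *)
Lemma null_mx_basis (R : realFieldType) r n (G : 'M[R]_n) (xi V V' : 'M[R]_(r, n)) :
  xi *m G *m V^T \in unitmx -> xi *m G *m V'^T \in unitmx ->
  (V' <= V)%MS -> null_mx G xi V' = null_mx G xi V.
Proof.
move=> uV uV' /submxP [A VA].
suff E1 : (invmx (xi *m G *m V'^T))^T *m V' = (invmx (xi *m G *m V^T))^T *m V.
  by rewrite /null_mx E1.
rewrite {2}VA mulmxA; congr (_ *m _); apply: (can_inj (@trmxK _ _ _)).
rewrite trmx_mul !trmxK -[LHS](mulKmx uV) {1}[in xi *m G *m V^T *m _]mulmxA.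
by rewrite -[_ *m _ *m A^T]mulmxA -trmx_mul -VA mulmxV // mulmx1.
Qed.

(** * Charts and the invariance of the Lie bracket *)
Section Charts.
Context {R : realType} {n : nat} {M : manifold R n}.
Implicit Types (b c d : chart R M n) (p : M) (U : set M).
Notation V := 'rV[R]_n.

Definition chart_img c U : set V := cmap c @` (U `&` cdom c).

Lemma cinvK c p : cdom c p -> cinv c (cmap c p) = p.
Proof. by move=> cp; apply: cmapK; rewrite inE. Qed.

Lemma chart_img_mem c U p : U p -> cdom c p -> chart_img c U (cmap c p).
Proof. by move=> Up cp; exists p. Qed.

Lemma chart_imgP c U x : chart_img c U x ->
  [/\ U (cinv c x), cdom c (cinv c x) & cmap c (cinv c x) = x].
Proof. by move=> [p [Up cp] <-]; rewrite cinvK. Qed.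

Lemma chart_img_open c U : open U -> open (chart_img c U).
Proof.
move=> oU; rewrite openE => x [p [Up cp] <-].
have cont : {for cmap c p, continuous (cinv c)} by apply: cinv_continuous; exists p.
have N1 : nbhs (cmap c p) (cmap c @` cdom c).
  by apply: open_nbhs_nbhs; split; [exact: cimg_open | exists p].
have N2 : nbhs (cmap c p) (cinv c @^-1` U).
  by apply: cont; rewrite cinvK //; apply: open_nbhs_nbhs.
apply: filterS2 N1 N2 => _ [p' cp' <-] /=; rewrite cinvK // => Up'.
by exists p'.
Qed.

Lemma near_chart_img c U p : open U -> U p -> cdom c p -> \forall x \near cmap c p, chart_img c U x.
Proof.
move=> oU Up cp; apply: open_nbhs_nbhs; split; first exact: chart_img_open.
exact: chart_img_mem.
Qed.

Lemma continuous_chart (T : topologicalType) (f : M -> T) c p : cdom c p ->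
  {for cmap c p, continuous (f \o cinv c)} -> {for p, continuous f}.
Proof.
move=> cp fc.
have C : ((f \o cinv c) \o cmap c) x @[x --> p] --> f p.
  apply: (@cvg_comp _ _ _ (cmap c) (f \o cinv c) _ (nbhs (cmap c p))).
    exact: cmap_continuous.
  have -> : f p = (f \o cinv c) (cmap c p) by rewrite /= cinvK.
  exact: fc.
apply: cvg_trans C; apply: near_eq_cvg.
have : nbhs p (cdom c) by apply: open_nbhs_nbhs; split; [exact: cdom_open|].
by apply: filterS => y cy /=; rewrite cinvK.
Qed.

Lemma transition_diff c d p : atlas c -> atlas d -> cdom c p -> cdom d p ->
  differentiable (cmap d \o cinv c) (cmap c p).
Proof.
move=> ac ad cp dp; have [_ [df _]] := atlas_smooth ac ad 1%N.
by apply: df; exists p.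
Qed.

(** The chain rule for changes of coordinates, from which all rules relating components in
    different charts are derived. *)
Lemma transition_comp b c d p v : atlas b -> atlas c -> atlas d ->
  cdom b p -> cdom c p -> cdom d p ->
  'd (cmap d \o cinv b) (cmap b p) v =
  'd (cmap d \o cinv c) (cmap c p) ('d (cmap c \o cinv b) (cmap b p) v).
Proof.
move=> ab ac ad bp cp dp.
have d1 := transition_diff ab ac bp cp.
have d2 : differentiable (cmap d \o cinv c) ((cmap c \o cinv b) (cmap b p)).
  by rewrite /= cinvK //; exact: transition_diff.
have D := diff_comp d1 d2; have dd := differentiable_comp d1 d2.
have E : \forall x \near cmap b p,
   ((cmap d \o cinv c) \o (cmap c \o cinv b)) x = (cmap d \o cinv b) x.
  apply: filterS (near_chart_img (cdom_open c) cp bp) => x /chart_imgP [cx _ _] /=.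
  by rewrite cinvK.
have [_ H] := near_eq_diff (f := (cmap d \o cinv c) \o (cmap c \o cinv b))
  (g := cmap d \o cinv b) E dd.
apply: (etrans (congr1 (@^~ v) H)); apply: (etrans (congr1 (@^~ v) D)).
by rewrite /= cinvK.
Qed.

Lemma transition_id c p v : cdom c p -> 'd (cmap c \o cinv c) (cmap c p) v = v.
Proof.
move=> cp.
have E : \forall x \near cmap c p, id x = (cmap c \o cinv c) x.
  by apply: filterS (near_chart_img openT (I : setT p) cp) => x /chart_imgP [_ _] /= ->.
have [_ H] := is_diff_near E (is_diff_id (cmap c p)).
exact: (congr1 (@^~ v) H).
Qed.

Lemma tcompK c p v : atlas c -> cdom c p -> tvec c p (tcomp c p v) = v.
Proof.
move=> ac cp; rewrite /tvec /tcomp -transition_comp ?transition_id //;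
  exact: chart_at_atlas || exact: chart_at_dom.
Qed.

Lemma tcomp_chart_at p v : tcomp (chart_at p) p v = v.
Proof. by rewrite /tcomp transition_id //; exact: chart_at_dom. Qed.

Definition tcomp_mx c p : 'M[R]_n := lin1_mx (tcomp c p).
Definition tvec_mx c p : 'M[R]_n := lin1_mx (tvec c p).

Lemma mul_tcomp_mx c p v : v *m tcomp_mx c p = tcomp c p v.
Proof. exact: (mul_rV_lin1 ('d (cmap c \o cinv (chart_at p)) (cmap (chart_at p) p))). Qed.

Lemma mul_tvec_mx c p v : v *m tvec_mx c p = tvec c p v.
Proof. exact: (mul_rV_lin1 ('d (cmap (chart_at p) \o cinv c) (cmap c p))). Qed.

Lemma tcomp_tvec_mx c p : atlas c -> cdom c p -> tcomp_mx c p *m tvec_mx c p = 1%:M.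
Proof.
move=> ac cp; apply/row_matrixP => i; rewrite !rowE mulmxA mul_tcomp_mx mul_tvec_mx mulmx1.
exact: tcompK.
Qed.

Lemma tvec_tcomp_mx c p : atlas c -> cdom c p -> tvec_mx c p *m tcomp_mx c p = 1%:M.
Proof. by move=> ac cp; apply: mulmx1C; exact: tcomp_tvec_mx. Qed.

Lemma tcomp_mx_chart_at p : tcomp_mx (chart_at p) p = 1%:M.
Proof. by apply/row_matrixP => i; rewrite !rowE mul_tcomp_mx tcomp_chart_at mulmx1. Qed.

(** The rows of B q are components in the chart selected at q, which varies with q; those of
    [chart_frame c B] refer to one chart and may be differentiated. *)
Definition chart_frame k c (B : M -> 'M[R]_(k, n)) (x : V) : 'M[R]_(k, n) :=
  B (cinv c x) *m tcomp_mx c (cinv c x).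

Definition chart_coframe k c (Th : M -> 'M[R]_(n, k)) (x : V) : 'M[R]_(n, k) :=
  tvec_mx c (cinv c x) *m Th (cinv c x).

Lemma chart_frame_coframe k l c (B : M -> 'M[R]_(k, n)) (Th : M -> 'M[R]_(n, l)) U x :
  atlas c -> chart_img c U x ->
  chart_frame c B x *m chart_coframe c Th x = B (cinv c x) *m Th (cinv c x).
Proof.
by move=> ac /chart_imgP [_ cx _]; rewrite mulmxA -[B _ *m _ *m _]mulmxA tcomp_tvec_mx // mulmx1.
Qed.

Definition smooth_frame k U (B : M -> 'M[R]_(k, n)) :=
  forall c, atlas c -> entries (fun f : V -> R => smooth (chart_img c U) f) (chart_frame c B).

Definition smooth_coframe k U (Th : M -> 'M[R]_(n, k)) :=
  forall c, atlas c -> entries (fun f : V -> R => smooth (chart_img c U) f) (chart_coframe c Th).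

Lemma smooth_vfieldP U (X : vfield M) : open U -> smooth_vfield U X <-> smooth_frame U X.
Proof.
move=> oU; have E c : (fun x => tcomp c (cinv c x) (X (cinv c x))) = chart_frame c X.
  by apply/funext => x; rewrite /chart_frame mul_tcomp_mx.
split=> H c ac.
  move=> i j k; rewrite ord1; apply: Ck_coord; first exact: chart_img_open.
  by rewrite -E; apply: H.
move=> k; rewrite E; apply: Ck_row; first exact: chart_img_open.
by move=> j; apply: H.
Qed.

Lemma smooth_frame_rows k U (B : M -> 'M[R]_(k, n)) :
  (forall a, smooth_frame U (fun p => row a (B p))) <-> smooth_frame U B.
Proof.
split=> H => [c ac i j|a c ac i j].
  have := H i c ac 0 j.
  by congr (smooth _ _); apply/funext => x; rewrite /chart_frame -row_mul [LHS]mxE.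
have := H c ac a j.
by congr (smooth _ _); apply/funext => x; rewrite /chart_frame -row_mul [RHS]mxE.
Qed.

Lemma smooth_frame_sub k U U' (B : M -> 'M[R]_(k, n)) : U' `<=` U ->
  smooth_frame U B -> smooth_frame U' B.
Proof.
move=> UU H c ac i j l; apply: Ck_sub (H c ac i j l).
by move=> _ [p [/UU Up cp] <-]; exists p.
Qed.

End Charts.

Section Bracket.
Context {R : realType} {n : nat} {M : manifold R n}.
Implicit Types (b c d : chart R M n) (p : M) (U : set M).
Notation V := 'rV[R]_n.

Definition chart_bracket (X Y : V -> V) (x : V) : V := mx_deriv Y x (X x) - mx_deriv X x (Y x).

Lemma chart_frame_vfield c (X : vfield M) x : chart_frame c X x = tcomp c (cinv c x) (X (cinv c x)).
Proof. by rewrite /chart_frame mul_tcomp_mx. Qed.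

Lemma vderiv_coord (Y : vfield M) c z i : atlas c -> cdom c z ->
  vderiv Y (fun z => cmap c z 0 i) z = tcomp c z (Y z) 0 i.
Proof.
move=> ac cz; rewrite /vderiv.
have := is_diff_coord i (transition_diff (chart_at_atlas z) ac (chart_at_dom z) cz).
by case=> _ /= ->.
Qed.

Lemma lie_bracket_chart_at U (X Y : vfield M) p : open U -> U p ->
  smooth_frame U X -> smooth_frame U Y ->
  lie_bracket X Y p =
  chart_bracket (chart_frame (chart_at p) X) (chart_frame (chart_at p) Y) (cmap (chart_at p) p).
Proof.
move=> oU Up sX sY; set c := chart_at p.
have ac : atlas c := chart_at_atlas p.
have cp : cdom c p := chart_at_dom p.
have val (W : vfield M) : chart_frame c W (cmap c p) = W p.
  by rewrite chart_frame_vfield cinvK // tcomp_chart_at.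
have key (W W' : vfield M) i : smooth_frame U W' ->
   vderiv W (vderiv W' (fun z => cmap c z 0 i)) p = mx_deriv (chart_frame c W') (cmap c p) (W p) 0 i.
  move=> sW'; rewrite [LHS]/vderiv mxE.
  have E : \forall x \near cmap c p,
     chart_frame c W' x 0 i = (vderiv W' (fun z => cmap c z 0 i) \o cinv c) x.
    apply: filterS (near_chart_img oU Up cp) => x /chart_imgP [Ux cx _] /=.
    by rewrite vderiv_coord // chart_frame_vfield.
  have dd : differentiable (fun x => chart_frame c W' x 0 i : R) (cmap c p).
    exact: (smooth_mx_differentiable (sW' c ac) (chart_img_mem Up cp)).
  by have [_ ->] := near_eq_diff E dd.
apply/rowP => i; rewrite mxE; cbv zeta; rewrite key // key // /chart_bracket !val.
by rewrite !mxE.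
Qed.

(** The i-th row of [jac_mx tau] is the derivative of tau along e_i, so that both sides are
    second derivatives of tau along u and v. *)
Lemma schwarz_jac (tau : V -> V) (A : set V) (x u v : V) : open A -> A x -> smooth A tau ->
  u *m mx_deriv (jac_mx tau) x v = v *m mx_deriv (jac_mx tau) x u.
Proof.
move=> oA Ax st; apply/rowP => j.
have E w w' : (w *m mx_deriv (jac_mx tau) x w') 0 j =
   'd (fun y => 'd (fun z => tau z 0 j : R) y w) x w'.
  rewrite mxE.
  have [_ ->] : is_diff x (fun y => 'd (fun z => tau z 0 j : R) y w)
     (fun w' => \sum_i w 0 i * 'd (fun y => 'd (fun z => tau z 0 j : R) y (delta_mx 0 i)) x w').
    apply: (is_diff_ext (f := fun y => \sum_i w 0 i *
       ('d (fun z => tau z 0 j : R) y (delta_mx 0 i)))) => //.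
      apply: is_diff_sum => i; apply: is_diffZ; apply: differentiableP.
      have [_ [_ H]] := Ck_coord j oA (st 2%N).
      by have [_ [dd _]] := H (delta_mx 0 i); exact: dd.
    by move=> y; rewrite diff_rowE.
  apply: eq_bigr => i _; rewrite mxE; congr (_ * ('d (_ : V -> R) x w')).
  by apply/funext => y; rewrite mxE.
rewrite !E; exact: schwarz oA Ax (Ck_coord j oA (st 2%N)).
Qed.

(** Under a change of coordinates tau, components are multiplied by the Jacobian matrix of
    tau.  Differentiating this relation produces, besides the expected term, the second
    derivative of tau applied to X and Y, which cancels in the bracket by symmetry. *)
Theorem lie_bracket_chart U (X Y : vfield M) p c : open U -> U p -> atlas c -> cdom c p ->
  smooth_frame U X -> smooth_frame U Y ->
  tcomp c p (lie_bracket X Y p) = chart_bracket (chart_frame c X) (chart_frame c Y) (cmap c p).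
Proof.
move=> oU Up ac cp sX sY; rewrite (lie_bracket_chart_at oU Up sX sY).
set c0 := chart_at p; have ac0 : atlas c0 := chart_at_atlas p.
have c0p : cdom c0 p := chart_at_dom p.
pose tau := cmap c \o cinv c0.
have taup : tau (cmap c0 p) = cmap c p by rewrite /tau /= cinvK.
have st : smooth (chart_img c0 (cdom c)) tau.
  have := atlas_smooth ac0 ac; rewrite /smooth_transition setIC; exact.
have oA : open (chart_img c0 (cdom c)) by apply: chart_img_open; exact: cdom_open.
have Ax : chart_img c0 (cdom c) (cmap c0 p) by exact: chart_img_mem.
have mtau (y : V) : chart_img c0 (cdom c) y -> mx_differentiable tau y.
  move=> Ay i j; rewrite ord1; have [_ [dd _]] := Ck_coord j oA (st 1%N); exact: dd.
have dtau (y v : V) : chart_img c0 (cdom c) y -> 'd tau y v = v *m jac_mx tau y.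
  move=> Ay; rewrite -mx_deriv_jac; apply/rowP => j; rewrite mxE.
  have dd : differentiable tau y by have [_ [dd _]] := st 1%N; exact: dd.
  by have [_ ->] := is_diff_coord j dd.
have mjac : mx_differentiable (jac_mx tau) (cmap c0 p).
  apply: smooth_mx_differentiable Ax; apply: smooth_jac => // i j k; rewrite ord1.
  exact: Ck_coord.
have trans (W : vfield M) : \forall x \near cmap c0 p,
    chart_frame c0 W x *m jac_mx tau x = (chart_frame c W \o tau) x.
  apply: filterS (near_chart_img (cdom_open c) cp c0p) => _ [z [cz c0z] <-].
  rewrite -dtau; last exact: chart_img_mem.
  rewrite /= !chart_frame_vfield /tau /= cinvK // cinvK //.
  rewrite /tcomp [RHS](transition_comp (c := c0)) //.
  - exact: chart_at_atlas.
  - exact: chart_at_dom.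
have val (W : vfield M) : chart_frame c W (cmap c p) = chart_frame c0 W
  (cmap c0 p) *m jac_mx tau (cmap c0 p).
  by rewrite (nbhs_singleton (trans W)) /= taup.
have deriv (W : vfield M) u : smooth_frame U W ->
   mx_deriv (chart_frame c W) (cmap c p) (u *m jac_mx tau (cmap c0 p)) =
   mx_deriv (chart_frame c0 W) (cmap c0 p) u *m jac_mx tau (cmap c0 p)
   + chart_frame c0 W (cmap c0 p) *m mx_deriv (jac_mx tau) (cmap c0 p) u.
  move=> sW.
  have m0 : mx_differentiable (chart_frame c0 W) (cmap c0 p)
    by apply: smooth_mx_differentiable (sW c0 ac0) (chart_img_mem Up c0p).
  have mc : mx_differentiable (chart_frame c W) (cmap c p)
    by apply: smooth_mx_differentiable (sW c ac) (chart_img_mem Up cp).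
  rewrite -mx_deriv_mul // -(mx_deriv_near _ (trans W)); last exact: mx_differentiable_mul.
  apply/matrixP => i j; rewrite !mxE.
  have d1 : differentiable tau (cmap c0 p) by have [_ [dd _]] := st 1%N; exact: dd.
  have d2 : differentiable (fun y => chart_frame c W y i j : R) (tau (cmap c0 p)).
    by rewrite taup; exact: (mc i j).
  have D := congr1 (@^~ u) (diff_comp d1 d2).
  by apply: esym; apply: etrans D _; rewrite /= taup dtau.
set u := chart_frame c0 X (cmap c0 p); set w := chart_frame c0 Y (cmap c0 p).
have E := congr2 (fun y z : V => y - z) (deriv Y u sY) (deriv X w sX).
rewrite [RHS]/chart_bracket (val X) (val Y); apply: etrans _ (esym E).
have Sw : w *m mx_deriv (jac_mx tau) (cmap c0 p) u = u *m mx_deriv (jac_mx tau) (cmap c0 p) w.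
  exact: schwarz_jac oA Ax st.
rewrite -/u -/w Sw opprD addrACA subrr addr0 -mulmxBl.
exact: dtau.
Qed.

End Bracket.

(** * Smooth functions and frames on the manifold *)
Lemma delta_mul_delta (R : pzSemiRingType) k l (A : 'M[R]_(k, l)) i j :
  ((delta_mx 0 i : 'rV_k) *m A *m (delta_mx 0 j : 'rV_l)^T) 0 0 = A i j.
Proof. by rewrite -rowE trmx_delta -colE !mxE. Qed.

Section SmoothFunctions.
Context {R : realType} {n : nat} {M : manifold R n}.
Implicit Types (c : chart R M n) (p : M) (U : set M).
Notation V := 'rV[R]_n.

Definition smooth_fun U (f : M -> R) :=
  forall c, atlas c -> smooth (chart_img c U) (f \o cinv c : V -> R).

Lemma smooth_fun_algebra U : open U -> function_algebra U (smooth_fun U).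
Proof.
move=> oU; have A c := smooth_algebra (chart_img_open (c := c) oU); split.
- by move=> a c ac; apply: (fa_cst (A c)).
- by move=> f g Hf Hg c ac; apply: (fa_add (A c) (Hf c ac) (Hg c ac)).
- by move=> f g Hf Hg c ac; apply: (fa_mul (A c) (Hf c ac) (Hg c ac)).
- move=> f f0 Hf c ac; apply: (fa_inv (A c) _ (Hf c ac)) => x /chart_imgP [Ux _ _].
  exact: f0.
- move=> f g fg Hf c ac; apply: (fa_congr (A c) _ (Hf c ac)) => x /chart_imgP [Ux _ _].
  exact: fg.
Qed.

Lemma smooth_fun_sub U U' f : U' `<=` U -> smooth_fun U f -> smooth_fun U' f.
Proof. by move=> UU H c ac k; apply: Ck_sub (H c ac k) => _ [p [/UU Up cp] <-]; exists p. Qed.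

Lemma entries_sub U U' a b (A : M -> 'M[R]_(a, b)) : U' `<=` U ->
  entries (smooth_fun U) A -> entries (smooth_fun U') A.
Proof. by move=> UU H i j; apply: smooth_fun_sub (H i j). Qed.

Lemma smooth_fun_sqrt U f : open U -> (forall p, U p -> 0 < f p) -> smooth_fun U f ->
  smooth_fun U (fun p => Num.sqrt (f p)).
Proof.
move=> oU f0 Hf c ac k; apply: Ck_sqrt (Hf c ac k); first exact: chart_img_open.
by move=> x /chart_imgP [Ux _ _]; apply: f0.
Qed.

Lemma smooth_fun_continuous U f p : U p -> smooth_fun U f -> {for p, continuous f}.
Proof.
move=> Up Hf; apply: (continuous_chart (c := chart_at p)); first exact: chart_at_dom.
apply: (Hf _ (chart_at_atlas p) 0%N).1; apply: chart_img_mem => //; exact: chart_at_dom.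
Qed.

Lemma smooth_fun_pos_near U f p : open U -> U p -> smooth_fun U f -> 0 < f p ->
  exists U', [/\ open U', U' p, U' `<=` U & forall x, U' x -> 0 < f x].
Proof.
move=> oU Up Hf fp.
have := cvgr_gt _ (smooth_fun_continuous Up Hf) 0 fp.
move=> N; have {}N : nbhs p (U `&` [set x | 0 < f x]).
  by apply: filterI; [apply: open_nbhs_nbhs | exact: N].
move: N; rewrite nbhsE => -[B [oB Bp] BU]; exists B; split=> //.
  by move=> x /BU [].
by move=> x /BU [].
Qed.

Lemma smooth_frame_mul k l U (A : M -> 'M[R]_(k, l)) (B : M -> 'M[R]_(l, n)) : open U ->
  entries (smooth_fun U) A -> smooth_frame U B -> smooth_frame U (fun p => A p *m B p).
Proof.
move=> oU HA HB c ac.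
have Al := smooth_algebra (chart_img_open (c := c) oU).
apply: (entries_congr Al (A := fun x => A (cinv c x) *m chart_frame c B x)).
  by move=> x _; rewrite /chart_frame mulmxA.
by apply: (entries_mul Al) (HB c ac) => i j; exact: HA.
Qed.

Lemma smooth_frame_add k U (A B : M -> 'M[R]_(k, n)) : open U ->
  smooth_frame U A -> smooth_frame U B -> smooth_frame U (fun p => A p + B p).
Proof.
move=> oU HA HB c ac; have Al := smooth_algebra (chart_img_open (c := c) oU).
apply: (entries_congr Al (A := fun x => chart_frame c A x + chart_frame c B x)).
  by move=> x _; rewrite /chart_frame mulmxDl.
exact: (entries_add Al (HA c ac) (HB c ac)).
Qed.

Lemma smooth_frame_opp k U (A : M -> 'M[R]_(k, n)) : open U ->
  smooth_frame U A -> smooth_frame U (fun p => - A p).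
Proof.
move=> oU HA c ac; have Al := smooth_algebra (chart_img_open (c := c) oU).
apply: (entries_congr Al (A := fun x => - chart_frame c A x)).
  by move=> x _; rewrite /chart_frame mulNmx.
exact: (entries_opp Al (HA c ac)).
Qed.

Lemma smooth_frame_col k l U (A : M -> 'M[R]_(k, n)) (B : M -> 'M[R]_(l, n)) :
  smooth_frame U A -> smooth_frame U B -> smooth_frame U (fun p => col_mx (A p) (B p)).
Proof.
move=> HA HB c ac i j.
rewrite (_ : (fun x => _) = fun x => match fintype.split i with
  inl a => chart_frame c A x a j | inr b => chart_frame c B x b j end).
  by case: (fintype.split i) => a; [apply: HA | apply: HB].
by apply/funext => x; rewrite /chart_frame mul_col_mx mxE.
Qed.

Lemma smooth_frame_congr k U (A B : M -> 'M[R]_(k, n)) : open U ->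
  (forall p, U p -> A p = B p) -> smooth_frame U A -> smooth_frame U B.
Proof.
move=> oU AB HA c ac; have Al := smooth_algebra (chart_img_open (c := c) oU).
apply: (entries_congr Al _ (HA c ac)) => x /chart_imgP [Ux _ _].
by rewrite /chart_frame AB.
Qed.

Variable g : metric M.

Lemma gram_smooth_chart c : atlas c ->
  entries (fun f : V -> R => smooth (chart_img c setT) f)
    (fun x => tvec_mx c (cinv c x) *m g (cinv c x) *m (tvec_mx c (cinv c x))^T).
Proof.
move=> ac i j.
have Al := smooth_algebra (chart_img_open (c := c) (@openT M)).
have := gram_smooth g (delta_mx 0 i) (delta_mx 0 j) ac.
have -> : cmap c @` cdom c = chart_img c setT by rewrite /chart_img setTI.
apply: (fa_congr Al) => x _ /=.
rewrite -!mul_tvec_mx -[RHS]delta_mul_delta; congr (fun_of_matrix _ 0 0).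
by rewrite trmx_mul !mulmxA.
Qed.

Lemma smooth_flat k U (B : M -> 'M[R]_(k, n)) : open U ->
  smooth_frame U B -> smooth_coframe U (fun p => g p *m (B p)^T).
Proof.
move=> oU HB c ac; have Al := smooth_algebra (chart_img_open (c := c) oU).
apply: (entries_congr Al (A := fun x =>
   (tvec_mx c (cinv c x) *m g (cinv c x) *m (tvec_mx c (cinv c x))^T) *m (chart_frame c B x)^T)).
  move=> x /chart_imgP [_ cx _].
  by rewrite /chart_frame /chart_coframe trmx_mul -!mulmxA [_^T *m
    (_^T *m _)]mulmxA -trmx_mul tcomp_tvec_mx // trmx1 mul1mx.
apply: (entries_mul Al); last exact: (entries_tr Al (HB c ac)).
move=> i j k'; apply: Ck_sub (gram_smooth_chart ac i j k') => _ [p [_ cp] <-].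
by exists p.
Qed.

Lemma smooth_coframe_mul k l U (Th : M -> 'M[R]_(n, k)) (A : M -> 'M[R]_(k, l)) : open U ->
  smooth_coframe U Th -> entries (smooth_fun U) A -> smooth_coframe U (fun p => Th p *m A p).
Proof.
move=> oU HT HA c ac; have Al := smooth_algebra (chart_img_open (c := c) oU).
apply: (entries_congr Al (A := fun x => chart_coframe c Th x *m A (cinv c x))).
  by move=> x _; rewrite /chart_coframe mulmxA.
by apply: (entries_mul Al (HT c ac)) => i j; exact: HA.
Qed.

Lemma smooth_coframe_row k l U (A : M -> 'M[R]_(n, k)) (B : M -> 'M[R]_(n, l)) :
  smooth_coframe U A -> smooth_coframe U B -> smooth_coframe U (fun p => row_mx (A p) (B p)).
Proof.
move=> HA HB c ac i j.
rewrite (_ : (fun x => _) = fun x => match fintype.split j with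
  inl a => chart_coframe c A x i a | inr b => chart_coframe c B x i b end).
  by case: (fintype.split j) => a; [apply: HA | apply: HB].
by apply/funext => x; rewrite /chart_coframe mul_mx_row mxE.
Qed.

Lemma smooth_fun_pairing k l U (B : M -> 'M[R]_(k, n)) (Th : M -> 'M[R]_(n, l)) : open U ->
  smooth_frame U B -> smooth_coframe U Th -> entries (smooth_fun U) (fun p => B p *m Th p).
Proof.
move=> oU HB HT i j c ac; have Al := smooth_algebra (chart_img_open (c := c) oU).
have H := entries_mul Al (HB c ac) (HT c ac) i j.
by apply: (fa_congr Al) H => x Hx; rewrite (chart_frame_coframe _ _ ac Hx).
Qed.

Lemma smooth_fun_gram k l U (B : M -> 'M[R]_(k, n)) (B' : M -> 'M[R]_(l, n)) : open U ->
  smooth_frame U B -> smooth_frame U B' ->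
  entries (smooth_fun U) (fun p => B p *m g p *m (B' p)^T).
Proof.
move=> oU HB HB' i j.
have := smooth_fun_pairing oU HB (smooth_flat oU HB') i j.
by apply: (fa_congr (smooth_fun_algebra oU)) => p _; rewrite mulmxA.
Qed.

Definition signs s (eps : 'I_s -> R) := forall a, eps a = 1 \/ eps a = -1.
Definition sign_mx s (eps : 'I_s -> R) : 'M[R]_s := diag_mx (\row_a eps a).

Lemma sign_mxK s (eps : 'I_s -> R) : signs eps -> sign_mx eps *m sign_mx eps = 1%:M.
Proof.
move=> He; rewrite mulmx_diag -diag_const_mx; congr diag_mx.
by apply/rowP => a; rewrite !mxE; case: (He a) => ->; rewrite ?mulrNN mulr1.
Qed.

Lemma sign_mx_block s t (e1 : 'I_s -> R) (e2 : 'I_t -> R) :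
  sign_mx (fun i : 'I_(s + t) => match fintype.split i with inl a => e1 a | inr b => e2 b end)
  = block_mx (sign_mx e1) 0 0 (sign_mx e2).
Proof.
rewrite -diag_mx_row; congr diag_mx; apply/rowP => i; rewrite !mxE.
by case: fintype.split => a; rewrite mxE.
Qed.

(** By polarization, a nonzero symmetric form has a vector v with nonzero square.  The
    matrix C is that of the transposition exchanging 0 and k with its first row replaced
    by v, where k is an index of a nonzero entry of v. *)
Lemma exists_nonisotropic s (h : 'M[R]_s.+1) : h^T = h -> h != 0 ->
  exists2 C : 'M[R]_s.+1, C \in unitmx & (C *m h *m C^T) 0 0 != 0.
Proof.
move=> hT h0.
have [v vh] : exists v : 'rV[R]_s.+1, (v *m h *m v^T) 0 0 != 0.
  apply: contrapT => H; move/negP: h0; apply; apply/eqP/matrixP => i j.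
  have q (v : 'rV_s.+1) : (v *m h *m v^T) 0 0 = 0 by apply/eqP/negPn/negP => vn; apply: H; exists v.
  have E a b : ((delta_mx 0 a : 'rV[R]_s.+1) *m h *m (delta_mx 0 b : 'rV[R]_s.+1)^T) 0 0 = h a b.
    exact: delta_mul_delta.
  have := q (delta_mx 0 i + delta_mx 0 j).
  (* the squares of e_i, e_j and e_i + e_j determine h_ij *)
  have D00 (A B : 'M[R]_1) : (A + B) 0 0 = A 0 0 + B 0 0 by rewrite mxE.
  rewrite linearD /= !(mulmxDl, mulmxDr) !D00.
  have := q (delta_mx 0 i); have := q (delta_mx 0 j); rewrite !E => -> ->.
  have -> : h j i = h i j by rewrite -{1}hT mxE.
  rewrite mxE; lra.
have v0 : v != 0 by apply: contraNneq vh => ->; rewrite !mul0mx mxE.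
have [k vk] : exists k, v 0 k != 0.
  apply: contrapT => H; move/negP: v0; apply; apply/eqP/rowP => k; rewrite mxE.
  by apply/eqP/negPn/negP => vn; apply: H; exists k.
pose C : 'M[R]_s.+1 := \matrix_(i, j) (if i == 0 then v 0 j else (tperm 0 k i == j)%:R).
exists C; last first.
  have E : row 0 C = v by apply/rowP => j; rewrite !mxE.
  by move: vh; rewrite -E -(delta_mul_delta (C *m h *m C^T)) rowE trmx_mul !mulmxA.
rewrite -row_free_unit -kermx_eq0; apply/rowV0P => a /sub_kermxP aC.
have Cj j : \sum_i a 0 i * C i j = 0 by have /rowP/(_ j) := aC; rewrite !mxE.
have a0 : a 0 0 = 0.
  have := Cj k; rewrite (bigD1 ord0) //= big1 ?addr0 => [|i i0].
    by rewrite mxE eqxx => /eqP; rewrite mulf_eq0 (negbTE vk) orbF => /eqP.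
  rewrite mxE (negbTE i0); case: eqP => [E|]; last by rewrite mulr0.
  case/eqP: i0; apply: (@perm_inj _ (tperm 0 k)); rewrite E tpermL //.
apply/rowP => i; rewrite mxE; have [->//|i0] := eqVneq i 0.
have := Cj (tperm 0 k i); rewrite (bigD1 ord0) //= a0 mul0r add0r.
rewrite (bigD1 i) //= big1 ?addr0 => [|j /andP[j0 ji]].
  by rewrite mxE (negbTE i0) eqxx mulr1.
rewrite mxE (negbTE j0); case: eqP => [E|]; last by rewrite mulr0.
by case/eqP: ji; apply: (@perm_inj _ (tperm 0 k)).
Qed.

Lemma entries_block k1 k2 l1 l2 U (A : M -> 'M[R]_(k1, l1)) (B : M -> 'M[R]_(k1, l2))
    (C : M -> 'M[R]_(k2, l1)) (D : M -> 'M[R]_(k2, l2)) :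
  entries (smooth_fun U) A -> entries (smooth_fun U) B -> entries (smooth_fun U) C ->
    entries (smooth_fun U) D ->
  entries (smooth_fun U) (fun x => block_mx (A x) (B x) (C x) (D x)).
Proof.
move=> HA HB HC HD i j.
rewrite (_ : (fun x => _) = fun x => match fintype.split i, fintype.split j with
  | inl a, inl b => A x a b | inl a, inr b => B x a b
  | inr a, inl b => C x a b | inr a, inr b => D x a b end).
  by case: (fintype.split i) => a; case: (fintype.split j) => b.
apply/funext => x; rewrite /block_mx mxE.
by case: (fintype.split i) => a; rewrite mxE; case: (fintype.split j) => b.
Qed.

(** Completing the square: the form splits off its pivot. *)
Lemma block_elim s (al : R) (u : 'rV[R]_s) (d : 'M[R]_s) : al != 0 ->
  let L := block_mx 1%:M 0 (- (al^-1 *: u^T)) 1%:M : 'M[R]_(1 + s) in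
  L *m block_mx al%:M u u^T d *m L^T
  = block_mx al%:M 0 0 (d - al^-1 *: (u^T *m u)).
Proof.
move=> al0 L; rewrite tr_block_mx !mulmx_block !trmx1 trmx0 !mul1mx !mul0mx !mulmx0 !mulmx1.
rewrite !addr0 linearN linearZ /= trmxK.
have E : al%:M *m (al^-1 *: u) = u by rewrite mul_scalar_mx scalerA divff // scale1r.
have E' : al^-1 *: u^T *m al%:M = u^T by rewrite mul_mx_scalar scalerA divff // scale1r.
rewrite mulmxN E addNr mulNmx E' addNr mul0mx add0r.
by rewrite mulNmx -scalemxAl addrC.
Qed.

(** Gram-Schmidt for an indefinite form depending smoothly on a point.  A constant change
    of basis makes the first diagonal entry nonzero at p, hence near p, with constant
    sign; that entry serves as pivot, and the Schur complement is treated by induction. *)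
Lemma orthonormalize s U (h : M -> 'M[R]_s) p : open U -> U p -> entries (smooth_fun U) h ->
  (forall x, U x -> (h x)^T = h x) -> h p \in unitmx ->
  exists U' (A : M -> 'M[R]_s) (eps : 'I_s -> R),
    [/\ open U', U' p, U' `<=` U, entries (smooth_fun U') A
      & signs eps /\ forall x, U' x -> A x *m h x *m (A x)^T = sign_mx eps].
Proof.
move=> + + + + +.
elim: s U h => [|s IH] U h oU Up sh hT hp.
  exists U, h, (fun=> 1); split=> //; split; first by move=> [].
  by move=> x _; rewrite flatmx0 [RHS]flatmx0.
have hp0 : h p != 0 by apply: contraTneq hp => ->; rewrite unitr0.
have [C uC Ch] := exists_nonisotropic (hT _ Up) hp0.
pose h1 x : 'M[R]_(1 + s) := C *m h x *m C^T.
pose al x := h1 x 0 0.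
have FA := smooth_fun_algebra oU.
have sh1 : entries (smooth_fun U) h1.
  apply: (entries_mul FA); last exact: (entries_cst FA).
  by apply: (entries_mul FA) sh; exact: (entries_cst FA).
(* the sign of the pivot, constant near p *)
have [sg [sgE sgp]] : exists sg : R, (sg = 1 \/ sg = -1) /\ 0 < sg * al p.
  have alp : al p != 0 := Ch.
  case: (ltrgtP (al p) 0) => [neg|pos|z]; last by rewrite z eqxx in alp.
    by exists (-1); split; [right | rewrite mulN1r oppr_gt0].
  by exists 1; split; [left | rewrite mul1r].
have sal : smooth_fun U (fun x => sg * al x) by apply: (fa_mul FA (fa_cst FA _)); exact: sh1.
have [U1 [oU1 U1p U1U posU1]] := smooth_fun_pos_near oU Up sal sgp.
have FA1 := smooth_fun_algebra oU1.
have al0 x : U1 x -> al x != 0.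
  by move=> /posU1; apply: contraTneq => ->; rewrite mulr0 ltxx.
have sal1 : smooth_fun U1 al by apply: smooth_fun_sub U1U _; exact: sh1.
pose u x : 'rV[R]_s := ursubmx (h1 x).
pose d x : 'M[R]_s := drsubmx (h1 x).
have su : entries (smooth_fun U1) u.
  move=> i j; rewrite (_ : (fun x => _) = fun x => h1 x (lshift s i) (rshift 1 j)).
    by apply: smooth_fun_sub U1U _; exact: sh1.
  by apply/funext => x; rewrite !mxE.
have sd : entries (smooth_fun U1) d.
  move=> i j; rewrite (_ : (fun x => _) = fun x => h1 x (rshift 1 i) (rshift 1 j)).
    by apply: smooth_fun_sub U1U _; exact: sh1.
  by apply/funext => x; rewrite !mxE.
have h1E x : U1 x -> h1 x = block_mx (al x)%:M (u x) (u x)^T (d x).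
  move=> /U1U Ux; have h1T : (h1 x)^T = h1 x by rewrite /h1 !trmx_mul trmxK hT // mulmxA.
  rewrite -[LHS]submxK; congr block_mx.
    apply/matrixP => i j; rewrite [LHS]mxE [LHS]mxE [RHS]mxE !ord1 eqxx mulr1n.
    by congr (h1 x _ _); apply: val_inj.
  by rewrite /u trmx_ursub h1T.
(* the Schur complement of the pivot *)
pose h2 x := d x - (al x)^-1 *: ((u x)^T *m u x).
have sal1V : smooth_fun U1 (fun x => (al x)^-1) by apply: (fa_inv FA1).
have sh2 : entries (smooth_fun U1) h2.
  apply: (entries_add FA1) => //; apply: (entries_opp FA1); apply: (entries_scale FA1) => //.
  by apply: (entries_mul FA1) => //; exact: (entries_tr FA1).
pose L x : 'M[R]_(1 + s) := block_mx 1%:M 0 (- ((al x)^-1 *: (u x)^T)) 1%:M.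
have Lh x : U1 x -> L x *m h1 x *m (L x)^T = block_mx (al x)%:M 0 0 (h2 x).
  by move=> U1x; rewrite h1E // block_elim // al0.
have sL : entries (smooth_fun U1) L.
  apply: entries_block; try exact: (entries_cst FA1).
  by apply: (entries_opp FA1); apply: (entries_scale FA1) => //; exact: (entries_tr FA1).
have h2T x : U1 x -> (h2 x)^T = h2 x.
  move=> U1x; rewrite /h2 linearB linearZ /= trmx_mul trmxK; congr (_ - _).
  by rewrite /d trmx_drsub /h1 !trmx_mul trmxK hT ?mulmxA //; exact: U1U.
have h2p : h2 p \in unitmx.
  have : L p *m h1 p *m (L p)^T \in unitmx.
    have uL : L p \in unitmx by rewrite unitmxE det_lblock !det1 mulr1 unitr1.
    by rewrite /h1 !unitmx_mul !unitmx_tr uL uC hp.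
  by rewrite Lh // !unitmxE det_ublock unitrM => /andP[].
have [U2 [A' [eps' [oU2 U2p U21 sA' [se' HA']]]]] := IH U1 h2 oU1 U1p sh2 h2T h2p.
have FA2 := smooth_fun_algebra oU2.
pose w x := (Num.sqrt (sg * al x))^-1.
have sw : smooth_fun U2 w.
  apply: (fa_inv FA2).
    by move=> x /U21 /posU1 pos; rewrite gt_eqF // sqrtr_gt0.
  apply: smooth_fun_sqrt => //; first by move=> x /U21 /posU1.
  by apply: smooth_fun_sub sal => x /U21 /U1U.
have w2 x : U2 x -> w x * al x * w x = sg.
  move=> /U21 U1x; have pos := posU1 _ U1x; have a0 := al0 _ U1x.
  rewrite mulrAC /w -invfM -expr2 sqr_sqrtr ?ltW // invfM -mulrA mulVf // mulr1.
  by case: sgE => ->; rewrite ?invr1 ?invrN1.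
exists U2, (fun x => block_mx (w x)%:M 0 0 (A' x) *m L x *m C),
  (fun i : 'I_(1 + s) => match fintype.split i with inl _ => sg | inr j => eps' j end).
split=> //.
- by move=> x /U21 /U1U.
- apply: (entries_mul FA2); last exact: (entries_cst FA2).
  apply: (entries_mul FA2); last exact: entries_sub U21 sL.
  have sw1 : entries (smooth_fun U2) (fun x => (w x)%:M : 'M[R]_1).
    move=> i j; rewrite (_ : (fun x => _) = w) //.
    by apply/funext => x; rewrite mxE !ord1 eqxx mulr1n.
  refine (@entries_block 1 s 1 s U2 _ (fun=> 0) (fun=> 0) _ sw1 _ _ sA');
    exact: (entries_cst FA2).
split; first by move=> i; case: fintype.split.
move=> x U2x; have U1x := U21 _ U2x.
set P := block_mx _ _ _ _.
have -> : P *m L x *m C *m h x *m (P *m L x *m C)^T = P *m (L x *m h1 x *m (L x)^T) *m P^T.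
  by rewrite /h1 !trmx_mul !mulmxA.
rewrite Lh // /P tr_block_mx !mulmx_block !(mulmx0, mul0mx, addr0, add0r, trmx0).
rewrite HA' // tr_scalar_mx -!scalar_mxM w2 // -/(1 + s)%N.
rewrite (sign_mx_block (fun _ : 'I_1 => sg)).
suff -> : sign_mx (fun _ : 'I_1 => sg) = sg%:M by [].
by apply/matrixP => i j; rewrite !mxE !ord1.
Qed.

End SmoothFunctions.

(** * Lie brackets with a frame *)
Section LieFrames.
Context {R : realType} {n : nat} {M : manifold R n}.
Implicit Types (c : chart R M n) (p : M) (U : set M) (Z : vfield M).
Notation V := 'rV[R]_n.

Definition lie_mx k Z (B : M -> 'M[R]_(k, n)) p : 'M[R]_(k, n) :=
  \matrix_a lie_bracket Z (fun q => row a (B q)) p.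

(** All brackets [Z, B_a] at once: the derivative of Z enters through B times the Jacobian
    matrix of Z. *)
Definition chart_bracket_mx k (Z : V -> V) (B : V -> 'M[R]_(k, n)) (x : V) : 'M[R]_(k, n) :=
  mx_deriv B x (Z x) - B x *m jac_mx Z x.

Lemma chart_bracket_row k (Z : V -> V) (B : V -> 'M[R]_(k, n)) a x :
  chart_bracket Z (fun y => row a (B y)) x = row a (chart_bracket_mx Z B x).
Proof.
rewrite /chart_bracket (mx_deriv_jac Z) /chart_bracket_mx [RHS]linearB /= row_mul; congr (_ - _).
apply/rowP => j; rewrite !mxE; congr ('d (_ : V -> R) _ _).
by apply/funext => y; rewrite [LHS]mxE.
Qed.

Lemma smooth_frame_row k U (B : M -> 'M[R]_(k, n)) a :
  smooth_frame U B -> smooth_frame U (fun q => row a (B q)).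
Proof. by move=> H; apply: (smooth_frame_rows _ _).2. Qed.

Lemma lie_mx_chart U c k Z (B : M -> 'M[R]_(k, n)) p : open U -> U p -> atlas c -> cdom c p ->
  smooth_frame U Z -> smooth_frame U B ->
  lie_mx Z B p *m tcomp_mx c p = chart_bracket_mx (chart_frame c Z) (chart_frame c B) (cmap c p).
Proof.
move=> oU Up ac cp sZ sB; apply/row_matrixP => a.
rewrite row_mul rowK mul_tcomp_mx.
rewrite (lie_bracket_chart oU Up ac cp sZ (smooth_frame_row a sB)).
have E : chart_frame c (fun q => row a (B q)) = fun x => row a (chart_frame c B x).
  by apply/funext => x; rewrite /chart_frame row_mul.
by apply: etrans (congr1 (fun W => chart_bracket (chart_frame c Z) W (cmap c p)) E) _;
  exact: chart_bracket_row.
Qed.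

Lemma lie_mx_pairing U c k l Z (B : M -> 'M[R]_(k, n)) (Th : M -> 'M[R]_(n, l)) p :
  open U -> U p -> atlas c -> cdom c p ->
  smooth_frame U Z -> smooth_frame U B ->
  lie_mx Z B p *m Th p = chart_bracket_mx (chart_frame c Z) (chart_frame c B)
    (cmap c p) *m chart_coframe c Th (cmap c p).
Proof.
move=> oU Up ac cp sZ sB; rewrite -(lie_mx_chart oU Up ac cp sZ sB) /chart_coframe cinvK //.
by rewrite mulmxA -[_ *m tcomp_mx c p *m _]mulmxA tcomp_tvec_mx // mulmx1.
Qed.

(** The value of tr(L Theta) on a field Z with Z Theta = 0, in terms of v = Z(p) alone. *)
Definition trace_form c k (B : M -> 'M[R]_(k, n)) (Th : M -> 'M[R]_(n, k)) (x v : V) : R :=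
  \tr (mx_deriv (chart_frame c B) x v *m chart_coframe c Th x)
  + \sum_a (v *m mx_deriv (chart_coframe c Th) x (row a (chart_frame c B x))) 0 a.

Lemma chart_frame_cmap c k (B : M -> 'M[R]_(k, n)) p : cdom c p ->
  chart_frame c B (cmap c p) = B p *m tcomp_mx c p.
Proof. by move=> cp; rewrite /chart_frame cinvK. Qed.

(** Only the second term of the bracket differentiates Z.  Since Z Theta = 0 near p, the
    Leibniz rule converts the derivative of Z times Theta into minus Z times the
    derivative of Theta. *)
Lemma trace_form_section U c k Z (B : M -> 'M[R]_(k, n)) (Th : M -> 'M[R]_(n, k)) p :
  open U -> U p -> atlas c -> cdom c p ->
  smooth_frame U Z -> smooth_frame U B -> smooth_coframe U Th ->
  (forall q, U q -> Z q *m Th q = 0) ->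
  \tr (lie_mx Z B p *m Th p) = trace_form c B Th (cmap c p) (tcomp c p (Z p)).
Proof.
move=> oU Up ac cp sZ sB sT ZT.
rewrite (lie_mx_pairing _ oU Up ac cp sZ sB) /chart_bracket_mx mulmxBl linearB /= /trace_form.
set x := cmap c p.
have -> : tcomp c p (Z p) = chart_frame c Z x by rewrite /chart_frame cinvK // mul_tcomp_mx.
congr (_ + _); rewrite /mxtrace -sumrN; apply: eq_bigr => a _.
have mZ : mx_differentiable (chart_frame c Z) x
  by apply: smooth_mx_differentiable (sZ c ac) (chart_img_mem Up cp).
have mT : mx_differentiable (chart_coframe c Th) x
  by apply: smooth_mx_differentiable (sT c ac) (chart_img_mem Up cp).
have E w : mx_deriv (chart_frame c Z) x w *m chart_coframe c Th x + chart_frame c Z x *m mx_deriv (chart_coframe c Th) x w = 0.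
  rewrite -mx_deriv_mul //.
  have N : \forall y \near x, (fun _ => 0 : 'rV[R]_k) y = chart_frame c Z y *m chart_coframe c Th y.
    apply: filterS (near_chart_img oU Up cp) => y Hy; have [Uy _ _] := chart_imgP Hy.
    by rewrite (chart_frame_coframe _ _ ac Hy) ZT.
  rewrite (mx_deriv_near _ N); first exact: mx_deriv_cst.
  by move=> i j; exact: differentiable_cst.
have := E (row a (chart_frame c B x)); rewrite mx_deriv_jac => /eqP.
rewrite addrC addr_eq0 => /eqP ->; rewrite [RHS]mxE; congr (- _).
by rewrite -row_mul -row_mul [RHS]mxE.
Qed.

Lemma trace_form_linear c k (B : M -> 'M[R]_(k, n)) (Th : M -> 'M[R]_(n, k)) x :
  linear (trace_form c B Th x : V -> R^o).
Proof.
move=> a u v; rewrite /trace_form mx_deriv_linear mulmxDl linearD /= -scalemxAl linearZ /=.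
rewrite scalerDr addrACA; congr (_ + _).
rewrite scaler_sumr -big_split; apply: eq_bigr => i _ /=.
by rewrite mulmxDl -scalemxAl mxE [X in X + _]mxE.
Qed.

Lemma smooth_trace_form U c k (B : M -> 'M[R]_(k, n)) (Th : M -> 'M[R]_(n, k)) (u : V -> V) :
  open U -> atlas c -> smooth_frame U B -> smooth_coframe U Th ->
  entries (fun f : V -> R => smooth (chart_img c U) f) u ->
  smooth (chart_img c U) (fun x => trace_form c B Th x (u x)).
Proof.
move=> oU ac sB sT su; have oI := chart_img_open (c := c) oU; have Al := smooth_algebra oI.
apply: (fa_add Al).
  apply: (fa_sum Al) => i.
  by apply: (entries_mul Al _ (sT c ac)); apply: smooth_mx_deriv => //; exact: sB.
apply: (fa_sum Al) => a; apply: (entries_mul Al su).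
apply: smooth_mx_deriv => //; first exact: sT.
move=> i j; apply: (fa_congr Al) (sB c ac a j) => x _.
by rewrite [RHS]mxE.
Qed.

Definition vderiv_mx k l Z (A : M -> 'M[R]_(k, l)) p : 'M[R]_(k, l) :=
  \matrix_(i, j) vderiv Z (fun q => A q i j) p.

Lemma vderiv_mxE k l Z (A : M -> 'M[R]_(k, l)) p :
  vderiv_mx Z A p = mx_deriv (A \o cinv (chart_at p)) (cmap (chart_at p) p) (Z p).
Proof. by apply/matrixP => i j; rewrite !mxE. Qed.

Lemma entries_differentiable U k l (A : M -> 'M[R]_(k, l)) p : U p -> entries (smooth_fun U) A ->
  mx_differentiable (A \o cinv (chart_at p)) (cmap (chart_at p) p).
Proof.
move=> Up sA; apply: (smooth_mx_differentiable (O := chart_img (chart_at p) U)).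
  by move=> i j; exact: (sA i j _ (chart_at_atlas p)).
exact: chart_img_mem (chart_at_dom p).
Qed.

Lemma near_chart_at U (P : M -> Prop) p : open U -> U p -> (forall q, U q -> P q) ->
  \forall x \near cmap (chart_at p) p, P (cinv (chart_at p) x).
Proof.
move=> oU Up UP; apply: filterS (near_chart_img oU Up (chart_at_dom p)) => x /chart_imgP [Ux _ _].
exact: UP.
Qed.

Lemma vderiv_mx_near U k l Z (A A' : M -> 'M[R]_(k, l)) p : open U -> U p ->
  entries (smooth_fun U) A -> (forall q, U q -> A q = A' q) -> vderiv_mx Z A' p = vderiv_mx Z A p.
Proof.
move=> oU Up sA AA; rewrite !vderiv_mxE; apply: mx_deriv_near; last exact: entries_differentiable sA.
exact: (near_chart_at oU Up AA).
Qed.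

Lemma vderiv_mx_cst k l Z (A : 'M[R]_(k, l)) p : vderiv_mx Z (fun=> A) p = 0.
Proof. by rewrite vderiv_mxE; exact: mx_deriv_cst. Qed.

Lemma vderiv_mx_mul U k l h Z (A : M -> 'M[R]_(k, l)) (C : M -> 'M[R]_(l, h)) p : U p ->
  entries (smooth_fun U) A -> entries (smooth_fun U) C ->
  vderiv_mx Z (fun q => A q *m C q) p = vderiv_mx Z A p *m C p + A p *m vderiv_mx Z C p.
Proof.
move=> Up sA sC; rewrite !vderiv_mxE.
have -> : (fun q => A q *m C q) \o cinv (chart_at p) =
  fun y => (A \o cinv (chart_at p)) y *m (C \o cinv (chart_at p)) y by [].
rewrite mx_deriv_mul /= ?cinvK //; try exact: chart_at_dom; exact: entries_differentiable Up _.
Qed.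

Lemma vderiv_mx_tr k l Z (A : M -> 'M[R]_(k, l)) p :
  vderiv_mx Z (fun q => (A q)^T) p = (vderiv_mx Z A p)^T.
Proof. by rewrite !vderiv_mxE -mx_deriv_tr. Qed.

Lemma vderiv_det U k Z (A : M -> 'M[R]_k) p : U p -> entries (smooth_fun U) A ->
  vderiv Z (fun q => \det (A q)) p = \tr (vderiv_mx Z A p *m \adj (A p)).
Proof.
move=> Up sA; rewrite vderiv_mxE.
have [_ H] := is_diff_det (entries_differentiable Up sA).
apply: etrans (congr1 (@^~ (Z p)) H) _.
by rewrite /= cinvK //; exact: chart_at_dom.
Qed.

Lemma lie_mx_chart_at U k Z (B : M -> 'M[R]_(k, n)) p : open U -> U p ->
  smooth_frame U Z -> smooth_frame U B ->
  lie_mx Z B p = chart_bracket_mx (chart_frame (chart_at p) Z) (chart_frame (chart_at p) B)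
    (cmap (chart_at p) p).
Proof.
move=> oU Up sZ sB; rewrite -[LHS]mulmx1 -(tcomp_mx_chart_at p).
exact: lie_mx_chart oU Up (chart_at_atlas p) (chart_at_dom p) sZ sB.
Qed.

Lemma chart_frame_chart_at k (B : M -> 'M[R]_(k, n)) p : chart_frame (chart_at p) B (cmap
  (chart_at p) p) = B p.
Proof. by rewrite chart_frame_cmap ?tcomp_mx_chart_at ?mulmx1 //; exact: chart_at_dom. Qed.

Lemma smooth_frame_differentiable U k (B : M -> 'M[R]_(k, n)) p : U p -> smooth_frame U B ->
  mx_differentiable (chart_frame (chart_at p) B) (cmap (chart_at p) p).
Proof.
move=> Up sB; apply: smooth_mx_differentiable (sB _ (chart_at_atlas p)) (chart_img_mem Up _).
exact: chart_at_dom.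
Qed.

Lemma lie_mx_near U k Z (B B' : M -> 'M[R]_(k, n)) p : open U -> U p ->
  smooth_frame U Z -> smooth_frame U B -> (forall q, U q -> B q = B' q) ->
  lie_mx Z B' p = lie_mx Z B p.
Proof.
move=> oU Up sZ sB BB; have sB' := smooth_frame_congr oU BB sB.
apply: etrans (lie_mx_chart_at oU Up sZ sB') (etrans _ (esym (lie_mx_chart_at oU Up sZ sB))).
have e1 : chart_frame (chart_at p) B' (cmap (chart_at p) p) = chart_frame (chart_at p) B (cmap
  (chart_at p) p).
  by apply: etrans (chart_frame_chart_at B' p) (etrans (esym (BB _ Up)) (esym
    (chart_frame_chart_at B p))).
have N : \forall x \near cmap (chart_at p) p, chart_frame (chart_at p) B x = chart_frame
  (chart_at p) B' x.
  apply: filterS (near_chart_img oU Up (chart_at_dom p)) => x /chart_imgP [Ux _ _].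
  exact: (congr1 (fun W => W *m tcomp_mx (chart_at p) (cinv (chart_at p) x)) (BB _ Ux)).
have e2 := mx_deriv_near (chart_frame (chart_at p) Z (cmap (chart_at p) p)) N
  (smooth_frame_differentiable Up sB).
exact: (congr2 (fun a b : 'M[R]_(k, n) => a - b *m jac_mx (chart_frame (chart_at p) Z) (cmap
  (chart_at p) p)) e2 e1).
Qed.

Lemma chart_bracket_mx_mul k l (Z : V -> V) (A : V -> 'M[R]_(k, l)) (B : V -> 'M[R]_(l, n)) x :
  mx_differentiable A x -> mx_differentiable B x ->
  chart_bracket_mx Z (fun y => A y *m B y) x = mx_deriv A x (Z x) *m B x + A x *m chart_bracket_mx Z B x.
Proof. by move=> mA mB; rewrite /chart_bracket_mx mx_deriv_mul // mulmxBr !addrA !mulmxA. Qed.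

(** Leibniz rule of the bracket, for a change of frame with variable coefficients. *)
Lemma lie_mx_mul U k l Z (A : M -> 'M[R]_(k, l)) (B : M -> 'M[R]_(l, n)) p : open U -> U p ->
  smooth_frame U Z -> entries (smooth_fun U) A -> smooth_frame U B ->
  lie_mx Z (fun q => A q *m B q) p = vderiv_mx Z A p *m B p + A p *m lie_mx Z B p.
Proof.
move=> oU Up sZ sA sB; have sAB := smooth_frame_mul oU sA sB.
apply: etrans (lie_mx_chart_at oU Up sZ sAB) _.
rewrite (lie_mx_chart_at oU Up sZ sB) vderiv_mxE.
have E : chart_frame (chart_at p) (fun q => A q *m B q)
    = fun x => (A \o cinv (chart_at p)) x *m chart_frame (chart_at p) B x.
  by apply/funext => x; rewrite /chart_frame mulmxA.
apply: etrans (congr1 (fun W => chart_bracket_mx (chart_frame (chart_at p) Z) W (cmap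
  (chart_at p) p)) E) _.
apply: etrans (chart_bracket_mx_mul _ (entries_differentiable Up sA)
  (smooth_frame_differentiable Up sB)) _.
have -> : (A \o cinv (chart_at p)) (cmap (chart_at p) p) = A p.
  by rewrite /= cinvK //; exact: chart_at_dom.
by rewrite (chart_frame_chart_at B p) (chart_frame_chart_at Z p).
Qed.

(** With B1 = A B, the two traces differ by tr(Z(A) A^-1), the derivative of log |det A|
    along Z; it vanishes because A D A^T is the constant D1. *)
Theorem trace_frame_indep U k Z (B B1 : M -> 'M[R]_(k, n)) (Th Th1 : M -> 'M[R]_(n, k))
    (D D1 : 'M[R]_k) p :
  open U -> U p -> smooth_frame U Z -> smooth_frame U B ->
  smooth_coframe U Th -> smooth_frame U B1 ->
  (forall q, U q -> [/\ B1 q *m Th1 q = 1%:M, Th q = Th1 q *m (B1 q *m Th q),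
      B1 q = B1 q *m Th q *m B q
    & (B1 q *m Th q) *m D *m (B1 q *m Th q)^T = D1]) ->
  D^T = D -> D1^T = D1 -> D1 *m D1 = 1%:M ->
  \tr (lie_mx Z B1 p *m Th1 p) = \tr (lie_mx Z B p *m Th p).
Proof.
move=> oU Up sZ sB sT sB1 H DT D1T D1D1.
pose A q := B1 q *m Th q.
have sA : entries (smooth_fun U) A by exact: smooth_fun_pairing.
have [BT1 TA BA AD] := H _ Up.
have -> : lie_mx Z B1 p = lie_mx Z (fun q => A q *m B q) p.
  apply: (lie_mx_near oU Up sZ); first exact: smooth_frame_mul.
  by move=> q Uq; have [_ _ E _] := H _ Uq.
rewrite (lie_mx_mul oU Up sZ sA sB) mulmxDl linearD /=.
have -> : \tr (A p *m lie_mx Z B p *m Th1 p) = \tr (lie_mx Z B p *m Th p).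
  by rewrite -mulmxA mxtrace_mulC -mulmxA [in RHS]TA.
suff -> : \tr (vderiv_mx Z A p *m B p *m Th1 p) = 0 by rewrite add0r.
have AX : A p *m (B p *m Th1 p) = 1%:M by rewrite mulmxA -BA BT1.
have AY : A p *m (D *m (A p)^T *m D1) = 1%:M by rewrite !mulmxA AD D1D1.
(* two expressions of the inverse of A *)
have XY : B p *m Th1 p = D *m (A p)^T *m D1.
  by rewrite -[LHS]mul1mx -(mulmx1C AY) -[LHS]mulmxA AX mulmx1.
rewrite -mulmxA XY; set A' := vderiv_mx Z A p.
have dA : A' *m (D *m (A p)^T) + A p *m D *m A'^T = 0.
  have FA := smooth_fun_algebra oU.
  have sD : entries (smooth_fun U) (fun q => D *m (A q)^T).
    by apply: (entries_mul FA (entries_cst FA D)); exact: (entries_tr FA).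
  have := vderiv_mx_mul Z Up sA sD.
  rewrite (vderiv_mx_mul Z Up (entries_cst FA D) (entries_tr FA sA)) vderiv_mx_cst mul0mx add0r.
  rewrite vderiv_mx_tr -/A' => E; rewrite -[A p *m D *m _]mulmxA -E.
  rewrite (vderiv_mx_near (A := fun=> D1) _ oU Up) ?vderiv_mx_cst //.
    exact: (entries_cst FA).
  by move=> q Uq; have [_ _ _ <-] := H _ Uq; rewrite mulmxA.
have := congr1 (fun W => \tr (W *m D1)) dA; rewrite mulmxDl mul0mx linearD /= linear0.
have -> : \tr (A p *m D *m A'^T *m D1) = \tr (A' *m (D *m (A p)^T) *m D1).
  by rewrite -mxtrace_tr !trmx_mul trmxK DT D1T mxtrace_mulC.
rewrite -mulmxA; lra.
Qed.

(** Let A be the matrix of components of Y and L the matrix of the brackets [Z, B_k].  The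
    derivative of det A along Z is tr(Z(A) adj A), and the brackets [Z, Y_i] contribute
    tr((Z(A) + A L Theta) adj A); the difference is - det A tr(L Theta). *)
Theorem lie_deriv_volume U k Z (B : M -> 'M[R]_(k, n)) (Th : M -> 'M[R]_(n, k))
    (chi : kform M k) (d : R) (Y : 'I_k -> vfield M) p :
  open U -> U p -> smooth_frame U Z -> smooth_frame U B ->
  smooth_coframe U Th -> (forall j, smooth_frame U (Y j)) ->
  (forall q, U q -> forall v, chi q v = \det ((\matrix_j v j) *m Th q) * d) ->
  B p *m Th p = 1%:M ->
  (forall q, U q -> frame_mx Y q = frame_mx Y q *m Th q *m B q) ->
  lie_deriv Z chi Y p + \tr (lie_mx Z B p *m Th p) * chi p (fun j => Y j p) = 0.
Proof.
move=> oU Up sZ sB sT sY chiE BT YB.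
pose A q := frame_mx Y q *m Th q.
have sYm : smooth_frame U (frame_mx Y).
  apply: (smooth_frame_rows _ _).1 => a.
  by apply: smooth_frame_congr (sY a) => // q _; rewrite rowK.
have sA : entries (smooth_fun U) A by exact: smooth_fun_pairing.
have lY : lie_mx Z (frame_mx Y) p *m Th p
    = vderiv_mx Z A p + A p *m (lie_mx Z B p *m Th p).
  have -> : lie_mx Z (frame_mx Y) p = lie_mx Z (fun q => A q *m B q) p.
    apply: (lie_mx_near oU Up sZ); first exact: smooth_frame_mul.
    by move=> q Uq; rewrite -YB.
  by rewrite (lie_mx_mul oU Up sZ sA sB) mulmxDl -!mulmxA BT mulmx1.
rewrite /lie_deriv.
have -> : vderiv Z (fun x => chi x (fun j => Y j x)) p = \tr (vderiv_mx Z A p *m \adj (A p)) * d.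
  rewrite -(vderiv_det Z Up sA).
  pose E : M -> 'M[R]_1 := fun q => (chi q (fun j => Y j q))%:M.
  pose E' : M -> 'M[R]_1 := fun q => (\det (A q))%:M *m d%:M.
  have FA := smooth_fun_algebra oU.
  have sE : entries (smooth_fun U) (fun q => (\det (A q))%:M : 'M[R]_1).
    move=> i j; apply: (fa_congr FA) (entries_det FA sA) => q _.
    by rewrite mxE !ord1.
  have sc (f : M -> R) : vderiv_mx Z (fun q => (f q)%:M : 'M[R]_1) p 0 0 = vderiv Z f p.
    by rewrite mxE; congr (vderiv Z _ p); apply/funext => q; rewrite mxE.
  have EE : vderiv_mx Z E p = vderiv_mx Z E' p.
    apply: (vderiv_mx_near _ oU Up); first exact: (entries_mul FA sE (entries_cst FA _)).
    by move=> q Uq; rewrite /E' /E chiE // -scalar_mxM.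
  have := congr1 (fun W : 'M[R]_1 => W 0 0) EE; rewrite sc => ->.
  rewrite (vderiv_mx_mul Z Up sE (entries_cst FA _)) vderiv_mx_cst mulmx0 addr0 mul_mx_scalar.
  by rewrite mxE sc mulrC.
have -> : \sum_i chi p (fun j => if j == i then lie_bracket Z (Y i) p else Y j p)
   = \tr (lie_mx Z (frame_mx Y) p *m Th p *m \adj (A p)) * d.
  rewrite -det_subst_row mulr_suml; apply: eq_bigr => i _; rewrite chiE //.
  congr (\det _ * _); apply/row_matrixP => j; rewrite row_mul rowK.
  have -> : row j (subst_row (A p) (lie_mx Z (frame_mx Y) p *m Th p) i) =
     if j == i then row j (lie_mx Z (frame_mx Y) p *m Th p) else row j (A p).
    by apply/rowP => l; rewrite !mxE; case: eqP => _; rewrite !mxE.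
  case: eqP => [->|_]; rewrite row_mul rowK //.
  congr (_ *m _); congr (lie_bracket Z _ p).
  by apply/funext => q; rewrite rowK.
rewrite lY mulmxDl linearD /= chiE // -/(A p) -/(frame_mx Y p).
set Q := lie_mx Z B p *m Th p.
have -> : \tr (A p *m Q *m \adj (A p)) = \det (A p) * \tr Q.
  by rewrite mxtrace_mulC mulmxA mul_adj_mx mul_scalar_mx linearZ.
ring.
Qed.

End LieFrames.

(** * Orthonormal frames and the null frame *)
Section Frames.
Context {R : realType} {n : nat} {M : manifold R n}.
Variable g : metric M.
Implicit Types (U : set M) (p : M).

Lemma frame_mx_row k (B : M -> 'M[R]_(k, n)) p :
  frame_mx (fun a q => row a (B q)) p = B p.
Proof. by apply/row_matrixP => a; rewrite rowK. Qed.

Lemma smooth_frame_mx k U (X : 'I_k -> vfield M) : open U ->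
  (forall a, smooth_vfield U (X a)) -> smooth_frame U (frame_mx X).
Proof.
move=> oU H; apply: (smooth_frame_rows _ _).1 => a.
apply: (smooth_frame_congr oU (A := X a)); first by move=> q _; rewrite rowK.
by apply: (smooth_vfieldP _ oU).1.
Qed.

Lemma smooth_frame_local k U (B : M -> 'M[R]_(k, n)) :
  (forall p, U p -> exists U', [/\ open U', U' p & smooth_frame U' B]) -> smooth_frame U B.
Proof.
move=> H c ac i j l; apply: Ck_local => x /chart_imgP [Ux cx xE].
have [U' [oU' U'x sB]] := H _ Ux; exists (chart_img c U'); split.
- exact: chart_img_open.
- by rewrite -xE; apply: chart_img_mem.
- exact: sB.
Qed.

Lemma ip_gram k l (X : 'M[R]_(k, n)) (Y : 'M[R]_(l, n)) p a b :
  ip g p (row a X) (row b Y) = (X *m g p *m Y^T) a b.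
Proof. by rewrite /ip -[RHS]delta_mul_delta !rowE trmx_mul !mulmxA. Qed.

Lemma orthonormal_gramP k p (X : 'I_k -> 'rV[R]_n) (eps : 'I_k -> R) :
  Defs.orthonormal g p X eps <->
  signs eps /\ (\matrix_a X a) *m g p *m (\matrix_a X a)^T = sign_mx eps.
Proof.
have E a b : ip g p (X a) (X b) = ((\matrix_a X a) *m g p *m (\matrix_a X a)^T) a b.
  by rewrite -ip_gram !rowK.
split=> -[sg H]; split=> //.
  apply/matrixP => a b; rewrite -E H /sign_mx !mxE.
  by case: eqP => [->|_]; rewrite ?mulr1n ?mulr0n.
by move=> a b; rewrite E H /sign_mx !mxE; case: eqP => [->|_]; rewrite ?mulr1n ?mulr0n.
Qed.

Lemma unit_of_gram k (A h : 'M[R]_k) (eps : 'I_k -> R) : signs eps ->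
  A *m h *m A^T = sign_mx eps -> A \in unitmx.
Proof.
move=> se AhA; have := congr1 (mulmx^~ (sign_mx eps)) AhA.
by rewrite sign_mxK // -!mulmxA => /mulmx1_unit [].
Qed.

Lemma sign_mx_conj k (e f : 'I_k -> R) : signs f ->
  sign_mx f *m sign_mx e *m (sign_mx f)^T = sign_mx e.
Proof.
move=> sf; rewrite /sign_mx tr_diag_mx !mulmx_diag; congr diag_mx.
by apply/rowP => a; rewrite !mxE mulrAC; case: (sf a) => ->; rewrite ?mulrNN !mul1r.
Qed.

(** Changing the sign of one row reverses the orientation and keeps orthonormality. *)
Lemma sign_fix k (A : 'M[R]_k) : A \in unitmx ->
  exists2 f : 'I_k -> R, signs f & 0 < \det (sign_mx f *m A).
Proof.
case: k A => [|k] A uA.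
  by exists (fun=> 1); [move=> [] | rewrite det_mx00].
have : \det A != 0 by rewrite unitmxE unitfE in uA.
case: (ltrgtP (\det A) 0) => // dA _; last first.
  exists (fun=> 1); first by left.
  have -> : sign_mx (fun _ : 'I_k.+1 => 1 : R) = 1%:M.
    by apply/matrixP => i j; rewrite !mxE.
  by rewrite mul1mx.
exists (fun i => if i == 0 then -1 else 1).
  by move=> i; case: eqP; [right | left].
rewrite det_mulmx det_diag big_ord_recl big1 => [|i _]; rewrite !mxE //=.
by rewrite mulr1 mulN1r oppr_gt0.
Qed.

(** The positive determinants record that the orientation of the given frame is kept. *)
Lemma orthonormal_frame_near k U (D : tdistribution M) (X0 : 'I_k -> vfield M) p :
  open U -> U p -> is_frame U D X0 ->
  frame_mx X0 p *m g p *m (frame_mx X0 p)^T \in unitmx ->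
  exists U' X eps, [/\ open U', U' p, U' `<=` U, orthonormal_frame g U' D X eps
    & forall q, U' q -> exists2 A : 'M[R]_k, frame_mx X q = A *m frame_mx X0 q & 0 < \det A].
Proof.
move=> oU Up [sX0 bX0] uh; have sX := smooth_frame_mx oU sX0.
have sh := smooth_fun_gram g oU sX sX.
have hT q : U q -> (frame_mx X0 q *m g q *m (frame_mx X0 q)^T)^T
   = frame_mx X0 q *m g q *m (frame_mx X0 q)^T.
  by move=> _; rewrite (gram_tr (gram_sym g q)).
have [U1 [A [eps [oU1 U1p U1U sA [se AhA]]]]] := orthonormalize oU Up sh hT uh.
have [f sf fA] := sign_fix (unit_of_gram se (AhA _ U1p)).
have FA1 := smooth_fun_algebra oU1.
have sfA : entries (smooth_fun U1) (fun q => sign_mx f *m A q).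
  by apply: (entries_mul FA1) sA; exact: (entries_cst FA1).
have [U2 [oU2 U2p U21 pos]] := smooth_fun_pos_near oU1 U1p (entries_det FA1 sfA) fA.
pose B q := sign_mx f *m A q *m frame_mx X0 q.
have sB : smooth_frame U2 B.
  apply: smooth_frame_mul => //; first exact: entries_sub U21 sfA.
  by apply: smooth_frame_sub sX => q /U21 /U1U.
exists U2, (fun a q => row a (B q)), eps; split=> //.
- by move=> q /U21 /U1U.
- split; first split.
  + move=> a; apply: (smooth_vfieldP _ oU2).2; exact: smooth_frame_row.
  + move=> q U2q; rewrite frame_mx_row.
    have [f0 e0] := bX0 _ (U1U _ (U21 _ U2q)).
    have uAf : sign_mx f *m A q \in unitmx.
      by rewrite unitmxE unitfE gt_eqF // pos.
    split; first by rewrite /row_free mxrankMfree // mxrank_unit.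
    apply: eqmx_trans e0; apply: eqmxMfull; by rewrite row_full_unit.
  + move=> q U2q; apply/orthonormal_gramP; split=> //.
    have -> : \matrix_a row a (B q) = B q by exact: frame_mx_row.
    have <- := sign_mx_conj eps sf; rewrite -(AhA _ (U21 _ U2q)).
    by rewrite /B !trmx_mul !mulmxA.
- move=> q U2q; exists (sign_mx f *m A q); last exact: pos.
  by rewrite frame_mx_row.
Qed.

Lemma det_sign_mx_sqr k (e : 'I_k -> R) : signs e -> \det (sign_mx e) ^+ 2 = 1.
Proof. by move=> /sign_mxK /(congr1 determinant); rewrite det_mulmx det1. Qed.

(** Taking determinants, (det A)^4 = 1 since matrices of signs have determinant 1 or -1. *)
Lemma det_on_change k (A : 'M[R]_k) (e f : 'I_k -> R) : signs e -> signs f ->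
  A *m sign_mx e *m A^T = sign_mx f -> 0 < \det A -> \det A = 1.
Proof.
move=> se sf /(congr1 determinant); rewrite !det_mulmx det_tr => E A0.
have := det_sign_mx_sqr se; have := det_sign_mx_sqr sf; rewrite -E.
set a := \det A in E A0 *; set d := \det (sign_mx e) => H1 H2.
have a4 : a ^+ 4 = 1.
  have E2 : (a * d * a) ^+ 2 = a ^+ 4 * d ^+ 2 by ring.
  by rewrite E2 H2 mulr1 in H1.
by apply/eqP; rewrite -(@eqrXn2 _ 4) ?ler01 ?(ltW A0) // a4 expr1n.
Qed.

Lemma null_dualE r (X V : 'M[R]_(r, n)) p i :
  null_dual g p (fun j => row j X) (fun k => row k V) i = row i (null_mx (g p) X V).
Proof.
rewrite /null_dual /null_mx.
have -> : \matrix_(j, k) ip g p (row j X) (row k V) = X *m g p *m V^T.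
  by apply/matrixP => j k; rewrite mxE ip_gram.
set H := invmx _; rewrite linearB /=; congr (_ - _).
  rewrite row_mul mulmx_sum_row; apply: eq_bigr => k _.
  by rewrite !mxE.
rewrite row_mul mulmx_sum_row scaler_sumr; apply: eq_bigr => j _.
set K := H^T *m V *m g p *m _.
have -> : row i (2^-1 *: K) 0 j = 2^-1 * K i j by rewrite !mxE.
rewrite -scalerA; congr (_ *: _); rewrite {}/K.
have -> : (H^T *m V *m g p *m (H^T *m V)^T) i j
   = \sum_k \sum_l H k i * H l j * ip g p (row k V) (row l V).
  have -> : H^T *m V *m g p *m (H^T *m V)^T = H^T *m (V *m g p *m V^T) *m H.
    by rewrite trmx_mul trmxK !mulmxA.
  rewrite exchange_big /= mxE; apply: eq_bigr => l _.
  rewrite [in LHS]mxE big_distrl /=; apply: eq_bigr => k _.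
  by rewrite ip_gram mulrAC; congr (_ * _ * _); rewrite mxE.
rewrite scaler_suml; apply: eq_bigr => k _.
by rewrite scaler_suml.
Qed.

End Frames.

(** * The one-form and the volume form of the foliation *)
Lemma pairing_entry (R : realType) n k l (G : 'M[R]_n) (L : 'M[R]_(k, n)) (W : 'M[R]_(l, n))
    a b :
  (L *m (G *m W^T)) a b = pairing (G *m (row b W)^T) (row a L).
Proof. by rewrite /pairing -[LHS]delta_mul_delta !rowE trmx_mul !mulmxA. Qed.

Section Kappa.
Context {R : realType} {m q r : nat} {M : manifold R (m + q)}.
Variables (g : metric M) (F : foliation M) (S S' E : tdistribution M) (xi : 'I_r -> vfield M).
Hypothesis hS : screens r g F S S'.
Hypothesis hxi : is_frame setT (RadTF g F) xi.
Hypothesis hE : subbundle r E.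
Hypothesis hEc : is_direct_sum (screen_orth g S S') (RadTF g F) E.
Notation n := (m + q)%N.
Notation s := (m - r)%N.
Notation t := (q - r)%N.
Implicit Types (U : set M) (p : M) (Z : vfield M).

Lemma splitting p : lightlike_splitting (g p) (TF F p) (S p) (S' p) (E p) (RadTF g F p).
Proof.
have [_ _ h1 h2] := hS; have [a1 a2] := h1 p; have [b1 b2] := h2 p; have [c1 _] := hEc p.
by split=> //; [exact: gram_sym | exact: gram_nondegenerate].
Qed.

Let Xi := frame_mx xi.
Let N := frame_mx (Nfield g E xi).

Lemma smooth_Xi U : open U -> smooth_frame U Xi.
Proof.
move=> oU; apply: (smooth_frame_sub (@subsetT _ U)).
by apply: smooth_frame_mx; [exact: openT | exact: hxi.1].
Qed.

Lemma Xi_basis p : row_free (Xi p) /\ (Xi p :=: RadTF g F p)%MS.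
Proof. by have := hxi.2 p I. Qed.

(** [Nfield] uses a selected basis of E; the values of a smooth frame of E serve as well. *)
Lemma N_null p (V : 'M[R]_(r, n)) : is_basis (E p) V -> N p = null_mx (g p) (Xi p) V.
Proof.
move=> bV; have [xf xE] := Xi_basis p.
pose V0 : 'M[R]_(r, n) := xget 0 [set B | is_basis (E p) B].
have bV0 : is_basis (E p) V0 by apply: xgetI bV.
have -> : N p = null_mx (g p) (Xi p) V0.
  have XiE : (fun j => xi j p) = fun j => row j (Xi p) by apply/funext => j; rewrite rowK.
  apply/row_matrixP => i; rewrite rowK; apply: etrans _ (null_dualE g (Xi p) V0 p i).
  by rewrite /Nfield XiE.
apply: null_mx_basis.
- exact: (pairing_unit (splitting p) xf xE bV.2).
- exact: (pairing_unit (splitting p) xf xE bV0.2).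
- by rewrite bV0.2 bV.2.
Qed.

Lemma E_basis p : exists V : 'M[R]_(r, n), is_basis (E p) V.
Proof. by have [U [V [_ Up [_ bV]]]] := hE p; exists (frame_mx V p); exact: bV. Qed.

(** Near each point the N_i are rational expressions in the metric, xi and a smooth local
    frame of E. *)
Lemma smooth_N U : open U -> smooth_frame U N.
Proof.
move=> oU; apply: (smooth_frame_sub (@subsetT _ U)); apply: smooth_frame_local => p _.
have [U' [V [oU' U'p [sV bV]]]] := hE p; exists U'; split=> //.
have sVm := smooth_frame_mx oU' sV; have sX := smooth_Xi oU'.
have FA := smooth_fun_algebra oU'.
apply: (smooth_frame_congr oU' (A := fun q => null_mx (g q) (Xi q) (frame_mx V q))).
  by move=> x Ux; rewrite -N_null //; exact: bV.
have sH : entries (smooth_fun U') (fun x => (invmx (Xi x *m g x *m (frame_mx V x)^T))^T).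
  apply: (entries_tr FA); apply: (entries_inv FA); last exact: smooth_fun_gram.
  move=> x Ux; have [xf xE] := Xi_basis x.
  exact: (pairing_unit (splitting x) xf xE (bV x Ux).2).
have sW := smooth_frame_mul oU' sH sVm.
apply: smooth_frame_add => //; apply: smooth_frame_opp => //; apply: smooth_frame_mul => //.
by apply: (entries_scale FA (fa_cst FA _)); exact: smooth_fun_gram.
Qed.

Lemma trTFE p k (v : 'M[R]_(k, n)) :
  (v <= trTF g S' E xi p)%MS = (v <= N p + S' p)%MS.
Proof. by rewrite (adds_eqmx (genmxE _) (eqmx_refl _)). Qed.

Definition TF_frame (X : 'I_s -> vfield M) p : 'M[R]_(r + s, n) :=
  col_mx (Xi p) (frame_mx X p).
Definition TF_coframe (X : 'I_s -> vfield M) (eps : 'I_s -> R) p : 'M[R]_(n, r + s) :=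
  adapted_coframe (g p) (N p) (frame_mx X p) (sign_mx eps).

Section OneFrame.
Variables (U : set M) (X : 'I_s -> vfield M) (eps : 'I_s -> R).
Hypotheses (oU : open U) (hX : orthonormal_frame g U S X eps).

Lemma smooth_TF_frame : smooth_frame U (TF_frame X).
Proof.
apply: smooth_frame_col; first exact: smooth_Xi.
by apply: smooth_frame_mx => //; exact: hX.1.1.
Qed.

Lemma smooth_TF_coframe : smooth_coframe U (TF_coframe X eps).
Proof.
apply: smooth_coframe_row; first exact: (smooth_flat g oU (smooth_N oU)).
apply: (smooth_coframe_mul oU).
  by apply: (smooth_flat g oU); apply: smooth_frame_mx => //; exact: hX.1.1.
exact: (entries_cst (smooth_fun_algebra oU)).
Qed.

Variable p : M.
Hypothesis Up : U p.

Lemma X_gram : signs eps /\ frame_mx X p *m g p *m (frame_mx X p)^T = sign_mx eps.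
Proof. exact: (orthonormal_gramP g p (fun a => X a p) eps).1 (hX.2 p Up). Qed.

Lemma X_basis : (frame_mx X p :=: S p)%MS.
Proof. by have [] := hX.1.2 p Up. Qed.

Lemma TF_frame_coframe : TF_frame X p *m TF_coframe X eps p = 1%:M.
Proof.
have [V bV] := E_basis p; have [xf xE] := Xi_basis p; have [se gX] := X_gram.
rewrite /TF_coframe (N_null bV).
exact: (frame_coframe (splitting p) xf xE bV.2 X_basis gX (sign_mxK se)).
Qed.

Lemma TF_coframe_kernel k (v : 'M[R]_(k, n)) :
  (v *m TF_coframe X eps p == 0) = (v <= trTF g S' E xi p)%MS.
Proof.
have [V bV] := E_basis p; have [xf xE] := Xi_basis p; have [se gX] := X_gram.
rewrite trTFE /TF_coframe (N_null bV).
exact: (coframe_kernel (splitting p) xf xE bV.2 X_basis (sign_mxK se)).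
Qed.

Lemma TF_frame_basis : (TF_frame X p :=: TF F p)%MS.
Proof. by have [xf xE] := Xi_basis p; exact: (frame_TF (splitting p) xE X_basis). Qed.

Lemma TF_frame_gram :
  TF_frame X p *m (g p + g p *m (N p)^T *m (g p *m (N p)^T)^T) *m (TF_frame X p)^T
  = block_mx 1%:M 0 0 (sign_mx eps).
Proof.
have [V bV] := E_basis p; have [xf xE] := Xi_basis p; have [se gX] := X_gram.
rewrite (N_null bV).
exact: (frame_gram (splitting p) xf xE bV.2 X_basis gX).
Qed.

Lemma TF_expand k (v : 'M[R]_(k, n)) : (v <= TF F p)%MS ->
  v *m TF_coframe X eps p *m TF_frame X p = v.
Proof.
rewrite -TF_frame_basis => /submxP [C ->].
by rewrite -[C *m _ *m TF_coframe X eps p]mulmxA TF_frame_coframe mulmx1.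
Qed.

End OneFrame.

Lemma kappa_trace (X : 'I_s -> vfield M) eps Z p :
  \sum_(i < r) pairing (lambda_form g E xi i p) (lie_bracket Z (xi i) p)
  + \sum_(a < s) eps a * pairing (flat g p (X a p)) (lie_bracket Z (X a) p)
  = \tr (lie_mx Z (TF_frame X) p *m TF_coframe X eps p).
Proof.
have rowL i : (fun x => row (lshift s i) (TF_frame X x)) = xi i.
  by apply/funext => x; rewrite /TF_frame -row_usubmx col_mxKu rowK.
have rowR a : (fun x => row (rshift r a) (TF_frame X x)) = X a.
  by apply/funext => x; rewrite /TF_frame -row_dsubmx col_mxKd rowK.
rewrite /mxtrace big_split_ord /TF_coframe /adapted_coframe mul_mx_row /=.
congr (_ + _); apply: eq_bigr => i _.
  by rewrite row_mxEl pairing_entry !rowK rowL.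
rewrite row_mxEr mulmxA mul_mx_diag mxE mulrC pairing_entry !rowK rowR.
by rewrite mxE.
Qed.

Lemma orthonormal_frame_sub k U U' (D : tdistribution M) (X : 'I_k -> vfield M) eps :
  U' `<=` U -> orthonormal_frame g U D X eps -> orthonormal_frame g U' D X eps.
Proof.
move=> UU [[sX bX] oX]; split; [split|]; try by move=> x /UU; [apply: bX | apply: oX].
- move=> a c ac k'; apply: Ck_sub (sX a c ac k') => _ [x [/UU Ux cx] <-].
  by exists x.
- by move=> x /UU; apply: bX.
- by move=> x /UU; apply: oX.
Qed.

Lemma vsection_sub U U' (D : tdistribution M) Z : U' `<=` U -> vsection U D Z -> vsection U' D Z.
Proof.
move=> UU [sZ DZ]; split; last by move=> x /UU; apply: DZ.
by move=> c ac k; apply: Ck_sub (sZ c ac k) => _ [x [/UU Ux cx] <-]; exists x.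
Qed.

Lemma vsection_smooth U (D : tdistribution M) Z : open U -> vsection U D Z -> smooth_frame U Z.
Proof. by move=> oU [sZ _]; apply: (smooth_vfieldP _ oU).1. Qed.

Lemma orthonormal_frame_S p : exists U (X : 'I_s ->
  vfield M) eps, [/\ open U, U p & orthonormal_frame g U S X eps].
Proof.
have [sS _ _ _] := hS; have [U [X [oU Up fX]]] := sS p; have [fr eX] := fX.2 p Up.
have [U' [X' [eps [oU' U'p _ oX' _]]]] :=
  orthonormal_frame_near oU Up fX (S_gram_unit (splitting p) fr eX).
by exists U', X', eps.
Qed.

Lemma orthonormal_frame_S' p :
  exists U (W : 'I_t -> vfield M) eps, [/\ open U, U p & orthonormal_frame g U S' W eps].
Proof.
have [_ sS' _ _] := hS; have [U [X [oU Up fX]]] := sS' p; have [fr eX] := fX.2 p Up.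
have [U' [X' [eps [oU' U'p _ oX' _]]]] :=
  orthonormal_frame_near oU Up fX (S'_gram_unit (splitting p) fr eX).
by exists U', X', eps.
Qed.

Lemma tr_section_coframe U X eps Z : open U -> orthonormal_frame g U S X eps ->
  vsection U (trTF g S' E xi) Z -> forall p, U p -> Z p *m TF_coframe X eps p = 0.
Proof. by move=> oU hX [_ trZ] p Up; apply/eqP; rewrite (TF_coframe_kernel hX Up) trZ. Qed.

(** The form on TF for which all adapted frames have constant Gram matrices is that of
    [frame_gram]. *)
Lemma kappa_trace_indep U X eps X1 eps1 Z p : open U -> U p ->
  orthonormal_frame g U S X eps -> orthonormal_frame g U S X1 eps1 ->
  vsection U (trTF g S' E xi) Z ->
  \tr (lie_mx Z (TF_frame X1) p *m TF_coframe X1 eps1 p)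
  = \tr (lie_mx Z (TF_frame X) p *m TF_coframe X eps p).
Proof.
move=> oU Up hX hX1 trZ.
have bT k (D : 'M[R]_k) : D^T = D -> (block_mx (1%:M : 'M[R]_r) 0 0 D)^T = block_mx 1%:M 0 0 D.
  by move=> DT; rewrite tr_block_mx DT trmx1 !trmx0.
apply: (trace_frame_indep (B := TF_frame X) (B1 := TF_frame X1) (Th := TF_coframe X eps)
  (Th1 := TF_coframe X1 eps1) (D := block_mx 1%:M 0 0 (sign_mx eps))
  (D1 := block_mx 1%:M 0 0 (sign_mx eps1)) oU Up (vsection_smooth oU trZ)).
- exact: smooth_TF_frame oU hX.
- exact: smooth_TF_coframe oU hX.
- exact: smooth_TF_frame oU hX1.
- move=> x Ux.
  have B1E : TF_frame X1 x *m TF_coframe X eps x *m TF_frame X x = TF_frame X1 x.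
    by apply: (TF_expand hX Ux); rewrite (TF_frame_basis hX1 Ux).
  split; [by rewrite (TF_frame_coframe hX1 Ux) | | by rewrite B1E |].
    apply/eqP; rewrite -subr_eq0 mulmxA -{1}[TF_coframe X eps x]mul1mx -mulmxBl.
    rewrite (TF_coframe_kernel hX Ux) -(TF_coframe_kernel hX1 Ux) mulmxBl mul1mx.
    by rewrite -mulmxA (TF_frame_coframe hX1 Ux) mulmx1 subrr.
  have gram_change (A : 'M[R]_(r + s)) B K : A *m (B *m K *m B^T) *m A^T
      = (A *m B) *m K *m (A *m B)^T :> 'M[R]_(r + s).
    by rewrite (trmx_mul A B) !mulmxA.
  by rewrite -(TF_frame_gram hX Ux) -(TF_frame_gram hX1 Ux) gram_change B1E.
- by apply: bT; exact: tr_diag_mx.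
- by apply: bT; exact: tr_diag_mx.
- have [se _] := X_gram hX1 Up.
  by rewrite mulmx_block !mulmx0 !mul0mx !addr0 !add0r mulmx1 sign_mxK // -scalar_mx_block.
Qed.

(** The value of kappa on v, computed in the chart c from the component of v in tr(TF). *)
Definition kappa_form c (X : 'I_s -> vfield M) (eps : 'I_s -> R) p (v : 'rV[R]_n) : R :=
  trace_form c (TF_frame X) (TF_coframe X eps) (cmap c p)
    (tcomp c p (v - v *m TF_coframe X eps p *m TF_frame X p)).

(** The coefficients of w on the N_i and the W_b are kept constant. *)
Lemma tr_extension U (W : 'I_t -> vfield M) epsW p (w : 'rV[R]_n) : open U -> U p ->
  orthonormal_frame g U S' W epsW -> (w <= trTF g S' E xi p)%MS ->
  exists2 Z, vsection U (trTF g S' E xi) Z & Z p = w.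
Proof.
move=> oU Up hW; rewrite trTFE => /sub_addsmxP [[a b] /= wE].
have [_ WS] := hW.1.2 p Up.
have /submxP [b' bE] : (b *m S' p <= frame_mx W p)%MS by rewrite WS submxMl.
exists (fun x => a *m N x + b' *m frame_mx W x); last by rewrite wE bE.
split.
  apply: (smooth_vfieldP _ oU).2; apply: smooth_frame_add => //.
    by apply: (smooth_frame_mul oU) (smooth_N oU); exact: (entries_cst (smooth_fun_algebra oU)).
  apply: (smooth_frame_mul oU); first exact: (entries_cst (smooth_fun_algebra oU)).
  by apply: smooth_frame_mx => //; exact: hW.1.1.
move=> x Ux; rewrite trTFE addmx_sub_adds ?submxMl //.
by rewrite (submx_trans (submxMl _ _)) // (hW.1.2 x Ux).2.
Qed.

(** Since kappa vanishes on TF, only the component of v in tr(TF) matters; once extended to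
    a section, it is handled by the prescribed values.  Uniqueness and smoothness
    both rest on this. *)
Lemma is_kappa_local kappa U (X : 'I_s -> vfield M) eps (W : 'I_t -> vfield M) epsW p c v :
  is_kappa g F S S' E xi kappa ->
  open U -> U p -> atlas c -> cdom c p ->
  orthonormal_frame g U S X eps -> orthonormal_frame g U S' W epsW ->
  pairing (kappa p) v = kappa_form c X eps p v.
Proof.
move=> [k0 kZ] oU Up ac cp hX hW.
set w := v - v *m TF_coframe X eps p *m TF_frame X p.
have wtr : (w <= trTF g S' E xi p)%MS.
  rewrite -(TF_coframe_kernel hX Up) mulmxBl -[X in _ - X]mulmxA (TF_frame_coframe hX Up).
  by rewrite mulmx1 subrr.
have [Z trZ Zp] := tr_extension oU Up hW wtr.
have -> : pairing (kappa p) v = pairing (kappa p) w.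
  have PB a b : pairing (kappa p) (a - b) = pairing (kappa p) a - pairing (kappa p) b.
    by rewrite /pairing mulmxBl !mxE.
  by rewrite PB [X in _ = _ - X]k0 ?subr0 // -(TF_frame_basis hX Up) submxMl.
rewrite -{1}Zp (kZ U X eps W epsW Z oU hX hW trZ p Up) kappa_trace.
by rewrite (trace_form_section oU Up ac cp (vsection_smooth oU trZ) (smooth_TF_frame oU hX)
  (smooth_TF_coframe oU hX) (tr_section_coframe oU hX trZ)) Zp.
Qed.

Lemma kappa_form_linear c X eps p : linear (kappa_form c X eps p : 'rV[R]_n -> R^o).
Proof.
move=> a u v; rewrite /kappa_form -!mul_tcomp_mx -trace_form_linear; congr (trace_form _ _ _ _ _).
rewrite !scalemxAl -mulmxDl; congr (_ *m _).
by rewrite !mulmxDl opprD addrACA scalerBr !scalemxAl.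
Qed.

Lemma kappa_form_section U c X eps Z p : open U -> U p -> atlas c -> cdom c p ->
  orthonormal_frame g U S X eps -> vsection U (trTF g S' E xi) Z ->
  kappa_form c X eps p (Z p) = \tr (lie_mx Z (TF_frame X) p *m TF_coframe X eps p).
Proof.
move=> oU Up ac cp hX trZ.
rewrite (trace_form_section oU Up ac cp (vsection_smooth oU trZ) (smooth_TF_frame oU hX)
  (smooth_TF_coframe oU hX) (tr_section_coframe oU hX trZ)).
by rewrite /kappa_form (tr_section_coframe oU hX trZ Up) mul0mx subr0.
Qed.

(** At each point kappa is given by [kappa_form] for a selected orthonormal frame; another
    frame gives the same values on the intersection of the domains. *)
Lemma is_kappa_exists : exists kappa, is_kappa g F S S' E xi kappa.
Proof.
have ex p : exists w : 'cV[R]_n,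
  (forall v : 'rV[R]_n, (v <= TF F p)%MS -> pairing w v = 0) /\
  (forall U (X : 'I_s -> vfield M) eps Z, open U -> U p -> orthonormal_frame g U S X eps ->
     vsection U (trTF g S' E xi) Z ->
     pairing w (Z p) = \tr (lie_mx Z (TF_frame X) p *m TF_coframe X eps p)).
  have [U [X [eps [oU Up hX]]]] := orthonormal_frame_S p.
  pose c := chart_at p; have ac : atlas c := chart_at_atlas p.
  have cp : cdom c p := chart_at_dom p.
  pose w : 'cV[R]_n := \col_i kappa_form c X eps p (delta_mx 0 i).
  have lk := kappa_form_linear c X eps p.
  pose kM := GRing.isLinear.Build _ _ _ _ (kappa_form c X eps p : _ -> R^o) lk.
  pose kL : {linear 'rV[R]_n -> R^o} := HB.pack (kappa_form c X eps p : _ -> R^o) kM.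
  have wE v : pairing w v = kappa_form c X eps p v.
    rewrite -[RHS]/(kL v) {2}[v]row_sum_delta linear_sum /pairing mxE.
    by apply: eq_bigr => i _; rewrite linearZ mxE.
  exists w; split=> [v vTF|U1 X1 eps1 Z oU1 U1p hX1 trZ]; rewrite wE.
    rewrite -[RHS](linear0 kL) /=; congr (trace_form _ _ _ _ (tcomp _ _ _)).
    by rewrite (TF_expand hX Up vTF) !mul0mx !subrr.
  have oI : open (U `&` U1) by exact: openI.
  have hXI := orthonormal_frame_sub (@subIsetl _ U U1) hX.
  have hXI1 := orthonormal_frame_sub (@subIsetr _ U U1) hX1.
  have trI := vsection_sub (@subIsetr _ U U1) trZ.
  rewrite (kappa_form_section oI (conj Up U1p) ac cp hXI trI).
  exact: esym (kappa_trace_indep oI (conj Up U1p) hXI hXI1 trI).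
have [kappa kappaP] := boolp.choice ex; exists kappa; split.
  by move=> p v; exact: (kappaP p).1.
move=> U X eps W epsW Z oU hX hW trZ p Up; rewrite kappa_trace.
exact: (kappaP p).2 oU Up hX trZ.
Qed.

Lemma adapted_nbhs p : exists U (X : 'I_s -> vfield M) eps (W : 'I_t -> vfield M) epsW,
  [/\ open U, U p, orthonormal_frame g U S X eps & orthonormal_frame g U S' W epsW].
Proof.
have [U [X [eps [oU Up hX]]]] := orthonormal_frame_S p.
have [U1 [W [epsW [oU1 U1p hW]]]] := orthonormal_frame_S' p.
exists (U `&` U1), X, eps, W, epsW; split; [exact: openI | by [] | |].
- exact: orthonormal_frame_sub hX.
- exact: orthonormal_frame_sub hW.
Qed.

Lemma is_kappa_unique k1 k2 :
  is_kappa g F S S' E xi k1 -> is_kappa g F S S' E xi k2 -> k1 = k2.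
Proof.
move=> h1 h2; apply/funext => p.
have [U [X [eps [W [epsW [oU Up hX hW]]]]]] := adapted_nbhs p.
apply/matrixP => i j; rewrite ord1.
have E1 (k : cofield M) : k p i 0 = pairing (k p) (delta_mx 0 i).
  by rewrite /pairing -rowE mxE.
by rewrite !E1 (is_kappa_local _ h1 oU Up (chart_at_atlas p) (chart_at_dom p) hX hW)
  (is_kappa_local _ h2 oU Up (chart_at_atlas p) (chart_at_dom p) hX hW).
Qed.

Lemma is_kappa_smooth kappa : is_kappa g F S S' E xi kappa -> smooth_oneform kappa.
Proof.
move=> hk c a ac k; apply: Ck_local => _ [p cp <-].
have [U [X [eps [W [epsW [oU Up hX hW]]]]]] := adapted_nbhs p.
have oI : open (chart_img c U) by exact: chart_img_open.
exists (chart_img c U); split=> //; first exact: chart_img_mem.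
have Al := smooth_algebra oI.
pose B := chart_frame c (TF_frame X); pose Th := chart_coframe c (TF_coframe X eps).
have sB : entries (fun f : _ -> R => smooth (chart_img c U) f) B := smooth_TF_frame oU hX ac.
have sT : entries (fun f : _ -> R => smooth (chart_img c U) f) Th := smooth_TF_coframe oU hX ac.
pose u x : 'rV[R]_n := a - a *m Th x *m B x.
have su : entries (fun f : _ -> R => smooth (chart_img c U) f) u.
  apply: (entries_add Al (entries_cst Al a)); apply: (entries_opp Al).
  by apply: (entries_mul Al) sB; apply: (entries_mul Al (entries_cst Al a)).
have sl := smooth_trace_form oU ac (smooth_TF_frame oU hX) (smooth_TF_coframe oU hX) su.
apply: (Ck_congr oI) (sl k) => x Hx; have [Ux cx ex] := chart_imgP Hx.
apply: etrans _ (esym (is_kappa_local _ hk oU Ux ac cx hX hW)).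
rewrite /kappa_form ex; congr (trace_form _ _ _ _ _).
rewrite -mul_tcomp_mx -mul_tvec_mx mulmxBl -[a *m tvec_mx _ _ *m tcomp_mx _ _]mulmxA tvec_tcomp_mx // mulmx1.
by rewrite /u /B /Th /chart_frame /chart_coframe !mulmxA.
Qed.

Lemma is_kappa_trace kappa U X eps Z p : is_kappa g F S S' E xi kappa ->
  open U -> U p -> orthonormal_frame g U S X eps -> vsection U (trTF g S' E xi) Z ->
  pairing (kappa p) (Z p) = \tr (lie_mx Z (TF_frame X) p *m TF_coframe X eps p).
Proof.
move=> [_ kZ] oU Up hX trZ.
have [U1 [W [epsW [oU1 U1p hW]]]] := orthonormal_frame_S' p.
have oI : open (U `&` U1) by exact: openI.
rewrite (kZ _ X eps W epsW Z oI _ _ _ p) ?kappa_trace //.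
- exact: orthonormal_frame_sub hX.
- exact: orthonormal_frame_sub hW.
- exact: vsection_sub trZ.
Qed.

Section Volume.
Variables (O : M -> 'M[R]_(s, n) -> bool) (hO : orientation S O).

(** A positive frame given by the orientation remains positive when orthonormalized. *)
Lemma oriented_frame p : exists U (X : 'I_s -> vfield M) eps,
  [/\ open U, U p, orthonormal_frame g U S X eps & forall x, U x -> O x (frame_mx X x)].
Proof.
have [U [X0 [oU Up fX0 OX0]]] := hO.2 p; have [fr eX] := fX0.2 p Up.
have [U' [X [eps [oU' U'p U'U oX XA]]]] :=
  orthonormal_frame_near oU Up fX0 (S_gram_unit (splitting p) fr eX).
exists U', X, eps; split=> // x U'x; have [A -> dA] := XA x U'x.
rewrite hO.1 ?dA ?OX0 //; first exact: U'U.
  exact: fX0.2 (U'U _ U'x).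
by rewrite unitmxE unitfE gt_eqF.
Qed.

(** The basis selected in [chiF] is A X with A D A^T a matrix of signs and det A > 0, so
    det A = 1 and it may be replaced by X. *)
Lemma chiFE U (X : 'I_s -> vfield M) eps p (v : 'I_(r + s) -> 'rV[R]_n) :
  U p -> orthonormal_frame g U S X eps -> O p (frame_mx X p) ->
  chiF g S E xi O p v = \det ((\matrix_j v j) *m TF_coframe X eps p) * \det (sign_mx eps).
Proof.
move=> Up hX OX; have [se gX] := X_gram hX Up.
pose P : set 'M[R]_(s, n) := [set B | [/\ is_basis (S p) B, O p B
  & exists e, Defs.orthonormal g p (fun a => row a B) e]].
pose Y : 'M[R]_(s, n) := xget 0 P.
have PX : P (frame_mx X p).
  split=> //; first exact: hX.1.2.
  exists eps; rewrite (_ : (fun a => row a _) = fun a => X a p); first exact: hX.2.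
  by apply/funext => a; rewrite rowK.
have [bY OY [e oY]] : P Y by exact: xgetI PX.
have [se' gY] := (orthonormal_gramP g p (fun a => row a Y) e).1 oY.
have {}gY : Y *m g p *m Y^T = sign_mx e.
  by rewrite -gY; congr (_ *m _ *m _^T); apply/row_matrixP => a; rewrite rowK.
have /submxP [A YA] : (Y <= frame_mx X p)%MS by rewrite (X_basis hX Up) bY.2.
have uA : A \in unitmx.
  rewrite -row_free_unit /row_free eqn_leq rank_leq_row /= -{1}(eqP bY.1) YA.
  exact: mxrankM_maxl.
have dA : 0 < \det A.
  have := hO.1 p _ A (hX.1.2 p Up) uA; rewrite -YA OY OX.
  by move=> /esym/eqP <-.
have d1 : \det A = 1.
  apply: (det_on_change se se' _ dA).
  by rewrite -gX -gY YA trmx_mul !mulmxA.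
(* the coframe of chiF, without the signs contained in [TF_coframe] *)
pose T' := row_mx (g p *m (N p)^T) (g p *m Y^T).
have TE : T' = TF_coframe X eps p *m block_mx 1%:M 0 0 (sign_mx eps *m A^T).
  rewrite mul_row_block !mulmx0 addr0 add0r mulmx1; congr row_mx.
  by rewrite mulmxA -[g p *m _ *m _ *m _]mulmxA sign_mxK // mulmx1 YA trmx_mul mulmxA.
rewrite /chiF -/P -/Y /wedge_covectors.
have -> : \det (sign_mx eps) = \det (block_mx 1%:M 0 0 (sign_mx eps *m A^T) : 'M[R]_(r + s)).
  by rewrite det_ublock det1 mul1r det_mulmx det_tr d1 mulr1.
rewrite -det_mulmx -mulmxA -TE -[RHS]det_tr; congr (\det _); apply/matrixP => i j.
rewrite mxE [RHS]mxE mul_mx_row mxE; case: fintype.split => a.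
  by rewrite pairing_entry !rowK.
by rewrite pairing_entry rowK.
Qed.

Lemma lie_deriv_chiF kappa U Z (Y : 'I_(r + s) -> vfield M) p :
  is_kappa g F S S' E xi kappa -> open U -> U p ->
  vsection U (trTF g S' E xi) Z -> (forall j, vsection U (TF F) (Y j)) ->
  lie_deriv Z (chiF g S E xi O) Y p
  + pairing (kappa p) (Z p) * chiF g S E xi O p (fun j => Y j p) = 0.
Proof.
move=> hk oU Up trZ sY.
have [U1 [X [eps [oU1 U1p hX1 OX1]]]] := oriented_frame p.
have oI : open (U `&` U1) by exact: openI.
have hX := orthonormal_frame_sub (@subIsetr _ U U1) hX1.
have trI := vsection_sub (@subIsetl _ U U1) trZ.
have sYI j := vsection_sub (@subIsetl _ U U1) (sY j).
have Ip : (U `&` U1) p by [].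
rewrite (is_kappa_trace hk oI Ip hX trI).
apply: (lie_deriv_volume (d := \det (sign_mx eps)) oI Ip (vsection_smooth oI trI)
  (smooth_TF_frame oI hX) (smooth_TF_coframe oI hX)).
- by move=> j; exact: vsection_smooth oI (sYI j).
- by move=> x Ix v; rewrite (chiFE _ Ix hX) //; exact: OX1 Ix.2.
- by rewrite (TF_frame_coframe hX Ip).
- move=> x Ix; rewrite (TF_expand hX Ix) //; apply/row_subP => j; rewrite rowK.
  exact: (sYI j).2.
Qed.

End Volume.

End Kappa.

Theorem proposition6 (R : realType) (m q r : nat)
    (M : manifold R (m + q)) (g : metric M) (F : foliation M)
    (S S' : tdistribution M)
    (hrm : (1 <= r <= m - 1)%N) (hrq : (1 <= r <= q - 1)%N)
    (hF : lightlike r g F) (hS : screens r g F S S')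
    (xi : 'I_r -> vfield M) (hxi : is_frame setT (RadTF g F) xi)
    (E : tdistribution M) (hE : subbundle r E)
    (hEc : is_direct_sum (screen_orth g S S') (RadTF g F) E) :
  exists kappa : cofield M,
    [/\ unique (is_kappa g F S S' E xi) kappa,
        smooth_oneform kappa
      & forall O : M -> 'M[R]_(m - r, m + q) -> bool,
          orientation S O ->
          forall (U : set M) (Z : vfield M) (Y : 'I_(r + (m - r)) -> vfield M),
            open U ->
            vsection U (trTF g S' E xi) Z ->
            (forall j, vsection U (TF F) (Y j)) ->
            forall p, U p ->
              lie_deriv Z (chiF g S E xi O) Y p
              + pairing (kappa p) (Z p) * chiF g S E xi O p (fun j => Y j p) = 0].
Proof.
have [kappa hk] := is_kappa_exists hS hxi hE hEc.
exists kappa; split.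
- by split=> // kappa' hk'; exact: (is_kappa_unique hS hxi hE hEc hk hk').
- exact: (is_kappa_smooth hS hxi hE hEc hk).
- move=> O hO U Z Y oU trZ sY p Up.
  exact: (lie_deriv_chiF hS hxi hE hEc hO hk oU Up trZ sY).
Qed.
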